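(* Let $p$ be a prime and $A$ a commutative ring with $\mathbb{Q}\subseteq A$. The following are equivalent: (a) $\mathrm{Spec}\,D_p(A)$ is non-empty; (b) there exists a $p$-divisibility on $A$; (c) there is a ring homomorphism $\delta$ with $\delta(1)=1$ from $A$ into some field carrying a $p$-valuation. Moreover, $\mathrm{Spec}\,D_p(A)$ contains a $p$-archimedean element if and only if there is a ring homomorphism $\delta:A\to\mathbb{Q}_p$ with $\delta(1)=1$.
   Context: A divisibility on $A$ is a binary relation $|\subseteq A\times A$ such that for all $a,b,c$: (1) $a|a$; (2) $a|b,\ b|c\Rightarrow a|c$; (3) $a|b,\ a|c\Rightarrow a|b-c$; (4) $a|b\Rightarrow ac|bc$; (5) $0\nmid1$. A $p$-divisibility additionally satisfies for all $a,b$: (6) $0\nmid a\Rightarrow pa\nmid a$; (7) $p[(a^pb-b^pa)^2-(b^{p+1})^2]\ \big|\ (a^pb-b^pa)b^{p+1}$. It is $p$-archimedean if for all $a$ there is $m\in\mathbb{Z}$ with $p^m|a$. $\mathrm{Spec}\,D_p(A)$ is the set of $p$-divisibilities $|$ that are total ($a|b$ or $b|a$ for all $a,b$) and have cancellation ($0\nmid c,\ ac|bc\Rightarrow a|b$). A $p$-valuation on a field of characteristic $0$ is a valuation whose value group is discretely ordered with $v(p)$ minimal positive and whose residue field is $\mathbb{F}_p$. *)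

(* Defs.v *)
From HB Require Import structures.
From mathcomp Require Import all_boot all_order all_algebra.
Set Implicit Arguments. Unset Strict Implicit. Unset Printing Implicit Defensive.
Import Order.TTheory GRing.Theory Num.Theory.
Local Open Scope ring_scope.

Section Div.
Variable A : comUnitRingType.
Variable p : nat.
Implicit Types (d : A -> A -> Prop).

Definition divisibility d : Prop :=
  [/\ (forall a, d a a),
      (forall a b c, d a b -> d b c -> d a c),
      (forall a b c, d a b -> d a c -> d a (b - c)),
      (forall a b c, d a b -> d (a * c) (b * c)) &
      ~ d 0 1].

Definition p_divisibility d : Prop :=
  [/\ divisibility d,
      (forall a, ~ d 0 a -> ~ d (p%:R * a) a) &
      (forall a b,
         d (p%:R * ((a ^+ p * b - b ^+ p * a) ^+ 2 - (b ^+ p.+1) ^+ 2))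
           ((a ^+ p * b - b ^+ p * a) * b ^+ p.+1))].

(* p^m | a for some integer m (p^m with m : int, p being a unit in A) *)
Definition p_archimedean d : Prop :=
  forall a : A, exists m : int, d ((p%:R : A) ^ m) a.

Definition total_rel d : Prop := forall a b, d a b \/ d b a.

Definition has_cancellation d : Prop :=
  forall a b c, ~ d 0 c -> d (a * c) (b * c) -> d a b.

Definition in_SpecDp d : Prop :=
  [/\ p_divisibility d, total_rel d & has_cancellation d].
End Div.

Definition ring_hom (A B : nzRingType) (f : A -> B) : Prop :=
  [/\ (forall x y, f (x + y) = f x + f y),
      (forall x y, f (x * y) = f x * f y) & f 1 = 1].

Definition ordered_group (G : zmodType) (le : G -> G -> Prop) : Prop :=
  [/\ (forall x, le x x),
      (forall x y, le x y -> le y x -> x = y),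
      (forall x y z, le x y -> le y z -> le x z),
      (forall x y, le x y \/ le y x) &
      (forall x y z, le x y -> le (x + z) (y + z))].

(* extended order on G ∪ {oo}, with None = oo *)
Definition ole (G : zmodType) (le : G -> G -> Prop) (a b : option G) : Prop :=
  match a, b with
  | _, None => True
  | None, Some _ => False
  | Some x, Some y => le x y
  end.

Definition oadd (G : zmodType) (a b : option G) : option G :=
  match a, b with
  | Some x, Some y => Some (x + y)
  | _, _ => None
  end.

Definition valuation (K : fieldType) (G : zmodType) (le : G -> G -> Prop)
  (v : K -> option G) : Prop :=
  [/\ ordered_group le,
      (forall x, v x = None <-> x = 0),
      (forall x y, v (x * y) = oadd (v x) (v y)) &
      (forall x y, ole le (v x) (v (x + y)) \/ ole le (v y) (v (x + y)))].

(* p-valuation: value group (the image of nonzero elements) discretely ordered with v(p) its minimal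
   positive element, and residue field O_v / m_v isomorphic to F_p, expressed
   as a surjective ring homomorphism O_v -> 'F_p with kernel m_v. *)
Definition p_valuation (p : nat) (K : fieldType) (G : zmodType)
  (le : G -> G -> Prop) (v : K -> option G) : Prop :=
  [/\ valuation le v,
      (exists g, v (p%:R) = Some g /\ le 0 g /\ g <> 0 /\
         forall x : K, forall h, v x = Some h -> le 0 h -> h <> 0 -> le g h) &
      (let O := fun x : K => ole le (Some 0) (v x) in
       let m := fun x : K => ole le (Some 0) (v x) /\ v x <> Some 0 in
       exists res : K -> 'F_p,
         [/\ (forall x y, O x -> O y -> res (x + y) = res x + res y),
             (forall x y, O x -> O y -> res (x * y) = res x * res y),
             res 1 = 1,
             (forall x, O x -> (res x = 0 <-> m x)) &
             (forall r : 'F_p, exists x, O x /\ res x = r)])].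

Definition vp_rat (p : nat) (q : rat) : option int :=
  if q == 0 then None
  else Some ((logn p `|numq q|%N)%:Z - (logn p `|denq q|%N)%:Z).

(* K, with w : K -> Z ∪ {oo}, is a completion of Q for the p-adic valuation,
   i.e. K is (a copy of) Q_p: w is a valuation extending v_p on Q, Q is dense
   in K, and K is complete. *)
Definition is_Qp (p : nat) (K : fieldType) (w : K -> option int) : Prop :=
  [/\ valuation (fun x y : int => x <= y) w,
      (forall q : rat, w (ratr q) = vp_rat p q),
      (forall (x : K) (n : int), exists q : rat,
          ole (fun x y : int => x <= y) (Some n) (w (x - ratr q))) &
      (forall s : nat -> K,
        (forall n : int, exists N, forall i j, (N <= i)%N -> (N <= j)%N ->
            ole (fun x y : int => x <= y) (Some n) (w (s i - s j))) ->
        exists l : K, forall n : int, exists N, forall i, (N <= i)%N ->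
            ole (fun x y : int => x <= y) (Some n) (w (s i - l)))].

Definition char0 (K : fieldType) : Prop := forall n : nat, (n.+1)%:R != 0 :> K.

(* Main.v *)
From HB Require Import structures.
Require Import Defs.
From mathcomp Require Import all_boot all_order all_algebra.
From mathcomp Require Import generic_quotient ring_quotient fraction.
From mathcomp Require Import boolp classical_sets functions.
From mathcomp Require Import finfield.
From mathcomp Require Import ring zify.
Import Order.TTheory GRing.Theory Num.Theory.
Local Open Scope ring_scope.

Set Implicit Arguments. Unset Strict Implicit. Unset Printing Implicit Defensive.

(* Everything is phrased with valuation rings V of a field K. If V is the valuation ring
   of a p-valuation and phi : A -> K a ring homomorphism, the relation
   v (phi a) <= v (phi b) is a point of Spec D_p(A).
   Conversely, a p-divisibility that is maximal for inclusion has cancellation, so the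
   elements divisible by 0 form a prime ideal, and the quotients a/b with b | a form a
   subring O of the fraction field K of A modulo this ideal. By maximality O is maximal
   among the subrings of K not containing 1/p, which makes it a valuation ring, and
   axiom (7) says that the Kochen operator takes values in O. Hence t^p - t lies in pO for t
   in O; as X^p - X = prod_i (X - i) modulo p, the residue field is F_p and p generates
   the maximal ideal.
   In a p-archimedean point every element of A is, up to a power of p, the limit of a
   sequence of integers, which also converges in Q_p; this defines A -> Q_p. The field Q_p
   is itself the fraction field attached to a divisibility, on the ring of integer
   sequences f such that p^n divides f(n+1) - f(n). *)

(** * Subrings and valuation rings of a field *)

Record subring (K : fieldType) (V : K -> Prop) : Prop := Subring {
  subring1 : V 1;
  subringB : forall x y, V x -> V y -> V (x - y);
  subringM : forall x y, V x -> V y -> V (x * y) }.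

Section SubringTheory.
Variables (K : fieldType) (V : K -> Prop).
Hypothesis sV : subring V.

Lemma subring0 : V 0.
Proof. by rewrite -(subrr 1); apply: subringB => //; apply: subring1. Qed.

Lemma subringN x : V x -> V (- x).
Proof. by move=> Vx; rewrite -sub0r; apply: subringB => //; apply: subring0. Qed.

Lemma subringD x y : V x -> V y -> V (x + y).
Proof. by move=> Vx Vy; rewrite -[y]opprK; apply: subringB => //; apply: subringN. Qed.

Lemma subringX x n : V x -> V (x ^+ n).
Proof.
move=> Vx; elim: n => [|n IHn]; first exact: subring1.
by rewrite exprS; apply: subringM.
Qed.

Lemma subring_nat n : V n%:R.
Proof.
elim: n => [|n IHn]; first exact: subring0.
by rewrite -addn1 natrD; apply: subringD => //; apply: subring1.
Qed.

Lemma subring_int (z : int) : V z%:~R.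
Proof. by case: z => n; rewrite ?NegzE ?mulrNz; [|apply: subringN]; apply: subring_nat. Qed.

Lemma subring_sum (I : Type) (r : seq I) (P : pred I) (F : I -> K) :
  (forall i, P i -> V (F i)) -> V (\sum_(i <- r | P i) F i).
Proof.
move=> VF; elim/big_rec: _ => [|i x Pi Vx]; first exact: subring0.
by apply: subringD => //; exact: VF.
Qed.

Lemma subring_prod (I : Type) (r : seq I) (P : pred I) (F : I -> K) :
  (forall i, P i -> V (F i)) -> V (\prod_(i <- r | P i) F i).
Proof.
move=> VF; elim/big_rec: _ => [|i x Pi Vx]; first exact: subring1.
by apply: subringM => //; exact: VF.
Qed.

End SubringTheory.

Definition valring (K : fieldType) (V : K -> Prop) : Prop :=
  subring V /\ forall x, V x \/ V x^-1.

(* [V] is the valuation ring of a p-valuation: [p] generates its maximal ideal and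
   its residue field is F_p. *)
Definition p_valring (p : nat) (K : fieldType) (V : K -> Prop) : Prop :=
  [/\ valring V, ~ V p%:R^-1 &
      forall x, V x -> exists z : int, V ((x - z%:~R) / p%:R)].

(** [x] lies in the maximal ideal. With [c = 1 - x * y], one of [x / c] and [c / x] is in [V]; the
    first yields [c^-1], the second would yield [x^-1]. *)
Lemma valring_unit_subM (K : fieldType) (V : K -> Prop) x y :
  valring V -> V x -> ~ V x^-1 -> V y -> 1 - x * y != 0 /\ V (1 - x * y)^-1.
Proof.
move=> [sV tV] Vx nVx Vy.
have x0 : x != 0 by apply/eqP => x0; apply: nVx; rewrite x0 invr0; apply: subring0.
have c0 : 1 - x * y != 0.
  apply/eqP => /eqP; rewrite subr_eq0 => /eqP xy1; apply: nVx.
  by rewrite -[x^-1]mulr1 xy1 mulKf.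
split=> //; set c := 1 - x * y in c0 *.
have [Vxc|] := tV (x / c).
  have -> : c^-1 = 1 + x / c * y by rewrite /c in c0 *; field.
  by apply: subringD => //; [exact: subring1|apply: subringM].
rewrite invf_div => Vcx; case: nVx.
have -> : x^-1 = c / x + y by rewrite /c; field.
exact: subringD.
Qed.

Section ValringInt.
Variables (p : nat) (K : fieldType) (V : K -> Prop).
Hypotheses (pp : prime p) (vV : valring V) (nVp : ~ V p%:R^-1).
Let sV : subring V. Proof. by case: vV. Qed.

Lemma valring_p_neq0 : p%:R != 0 :> K.
Proof. by apply/eqP => p0; apply: nVp; rewrite p0 invr0; apply: subring0. Qed.
Let p0 := valring_p_neq0.

(** Bezout gives [u * z = 1 - p * v], a unit because [p] is in the maximal ideal. *)
Lemma valring_coprime_unit (z : int) :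
  ~~ (p %| z)%Z -> z%:~R != 0 :> K /\ V z%:~R^-1.
Proof.
move=> pz.
have /coprimezP [[u v] /= uv1] : coprimez z p.
  by rewrite coprimez_sym coprimezE /= prime_coprime.
have e : u%:~R * z%:~R = 1 - p%:R * v%:~R :> K.
  have h : u%:~R * z%:~R + v%:~R * p%:R = 1 :> K.
    by rewrite -[p%:R]/((p : int)%:~R) -!rmorphM -rmorphD uv1.
  by rewrite -[LHS](addrK (v%:~R * p%:R)) h [v%:~R * _]mulrC.
have [c0 Vc] := valring_unit_subM vV (subring_nat sV p) nVp (subring_int sV v).
have z0 : z%:~R != 0 :> K.
  by apply: contra c0; rewrite -e => /eqP ->; rewrite mulr0.
split=> //.
have -> : z%:~R^-1 = u%:~R * (1 - p%:R * v%:~R)^-1 :> K.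
  have u0 : u%:~R != 0 :> K by apply: contra c0; rewrite -e => /eqP ->; rewrite mul0r.
  by rewrite -e; field; rewrite z0.
by apply: subringM => //; apply: subring_int.
Qed.

(** On the integers [V] induces the p-adic valuation: once the factors [p] are removed, a unit
    remains, and dividing it by a positive power of [p] would give [1 / p]. *)
Lemma valring_int_div (z : int) n : V (z%:~R / p%:R ^+ n) -> (p%:Z ^+ n %| z)%Z.
Proof.
elim: n z => [|n IHn] z; first by rewrite dvd1z.
move=> Vz.
have [/dvdzP[y zE]|pz] := boolP (p %| z)%Z.
  rewrite zE exprSr dvdz_mul ?IHn //; move: Vz; rewrite zE rmorphM /= exprSr.
  by rewrite -mulf_div divff ?mulr1.
have [z0 Vz'] := valring_coprime_unit pz; case: nVp.
have -> : p%:R^-1 = z%:~R / p%:R ^+ n.+1 * p%:R ^+ n * z%:~R^-1 :> K.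
  by rewrite exprS; field; rewrite z0 p0 expf_neq0.
by do !apply: subringM => //; apply: subringX => //; apply: subring_nat.
Qed.

Lemma valring_div_int (z : int) n : (p%:Z ^+ n %| z)%Z -> V (z%:~R / p%:R ^+ n).
Proof.
move=> /dvdzP[y ->]; rewrite rmorphM rmorphXn /= mulfK ?expf_neq0 //.
exact: subring_int.
Qed.

End ValringInt.

Section PValring.
Variables (p : nat) (K : fieldType) (V : K -> Prop).
Hypotheses (pp : prime p) (pV : p_valring p V).

Let vV : valring V. Proof. by case: pV. Qed.
Let sV : subring V. Proof. by case: vV. Qed.
Let nVp : ~ V p%:R^-1. Proof. by case: pV. Qed.
Let p0 := valring_p_neq0 vV nVp.

(** [x] is congruent to an integer [z] modulo [p V]. If [p] does not divide [z], then [x] is [z]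
    times an element of [1 + p V], hence a unit. *)
Lemma p_valring_nonunit x : V x -> ~ V x^-1 -> V (x / p%:R).
Proof.
move=> Vx nVx; have [_ _ /(_ x Vx)[z Vz]] := pV.
have [pz|pz] := boolP (p %| z)%Z.
  have := @valring_div_int p K V vV nVp z 1; rewrite !expr1 => /(_ pz) Vzp.
  by have := subringD sV Vz Vzp; rewrite -mulrDl subrK.
have [z0 Vz'] := valring_coprime_unit pp vV nVp pz; case: nVx.
set y := (x - z%:~R) / p%:R in Vz.
have xE : x = z%:~R * (1 - p%:R * (- y / z%:~R)) by rewrite /y; field; rewrite z0.
have [_ Vc] := valring_unit_subM vV (subring_nat sV p) nVp (subringM sV (subringN sV Vz) Vz').
by rewrite xE invfM; apply: subringM.
Qed.

(** Modulo [p V] the element [x] is an integer [z], and [x - z] divides [x ^ p - z ^ p], so this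
    reduces to Fermat's little theorem for [z]. *)
Lemma p_valring_fermat x : V x -> V ((x ^+ p - x) / p%:R).
Proof.
move=> Vx; have [_ _ /(_ x Vx)[z Vz]] := pV.
have -> : (x ^+ p - x) / p%:R = (x - z%:~R) / p%:R * (\sum_(i < p) x ^+ (p.-1 - i) * z%:~R ^+ i)
   - (x - z%:~R) / p%:R + (z ^+ p - z)%:~R / p%:R.
  by rewrite mulrAC -subrXX rmorphB rmorphXn /=; field; rewrite p0.
have Vs : V (\sum_(i < p) x ^+ (p.-1 - i) * z%:~R ^+ i).
  by apply: subring_sum => // i _; apply: subringM => //; apply: subringX => //; apply: subring_int.
apply: subringD => //; first by apply: subringB => //; apply: subringM.
rewrite -[p%:R]expr1; apply: (valring_div_int vV nVp); rewrite expr1.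
have : ((z ^+ p - z)%:~R == 0 :> 'F_p).
  rewrite rmorphB rmorphXn /=; set t : 'F_p := _%:~R.
  by have := expf_card t; rewrite card_Fp // => ->; rewrite subrr.
by rewrite -(dvdz_pcharf (pchar_Fp pp)).
Qed.

Lemma p_valring_approx x n : V x -> exists z : int, V ((x - z%:~R) / p%:R ^+ n).
Proof.
move=> Vx; elim: n => [|n [z Vz]].
  by exists 0; rewrite expr0 divr1 subr0.
have [_ _ /(_ _ Vz)[y Vy]] := pV; exists (z + p%:Z ^+ n * y).
move: Vy; congr V; rewrite rmorphD rmorphM rmorphXn /= exprS.
by field; rewrite ?p0 expf_neq0 // p0.
Qed.

End PValring.

(** * The divisibility pulled back from a valuation ring *)

Lemma ring_hom_rmorphism (A B : nzRingType) (f : A -> B) :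
  ring_hom f -> exists g : {rmorphism A -> B}, f = g.
Proof.
case=> fD fM f1.
have f0 : f 0 = 0 by apply: (addrI (f 0)); rewrite -fD !addr0.
have fB : zmod_morphism f.
  by move=> x y; apply: (addIr (f y)); rewrite -fD !subrK.
have fm : monoid_morphism f by split.
pose g : {rmorphism A -> B} := HB.pack f (GRing.isZmodMorphism.Build A B f fB)
  (GRing.isMonoidMorphism.Build A B f fm).
by exists g.
Qed.

Lemma rmorphism_ring_hom (A B : nzRingType) (f : {rmorphism A -> B}) : ring_hom f.
Proof. by split; [exact: rmorphD | exact: rmorphM | exact: rmorph1]. Qed.

Section Pullback.
Variables (A : comUnitRingType) (K : fieldType) (phi : {rmorphism A -> K}).

(** For the valuation [v] of [V] this is [v (phi a) <= v (phi b)]. The first disjunct covers an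
    infinite right-hand side; the second asks for [phi a <> 0] since [x / 0 = 0] lies in every
    subring. *)
Definition pullback (V : K -> Prop) (a b : A) : Prop :=
  phi b = 0 \/ phi a <> 0 /\ V (phi b / phi a).

Lemma pullback0 V a : pullback V 0 a <-> phi a = 0.
Proof. by split=> [[//|[]]|]; [rewrite rmorph0|left]. Qed.

Lemma pullback_divisibility V : subring V -> divisibility (pullback V).
Proof.
move=> sV; split.
- move=> a; have [|/eqP a0] := eqVneq (phi a) 0; first by left.
  by right; rewrite divff ?(introN eqP) //; split=> //; apply: subring1.
- move=> a b c [b0|[a0 Vab]] [c0|[b0' Vbc]]; try by left.
  right; split=> //; have -> : phi c / phi a = phi c / phi b * (phi b / phi a).
    by rewrite mulrA divfK //; apply/eqP.
  exact: subringM.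
- move=> a b c; rewrite /pullback rmorphB; case=> [->|[a0 Vb]] [->|[a0' Vc]];
    rewrite ?subrr ?sub0r ?subr0.
  + by left.
  + by right; rewrite mulNr; split=> //; apply: subringN.
  + by right.
  + by right; rewrite mulrBl; split=> //; apply: subringB.
- move=> a b c; rewrite /pullback !rmorphM; case=> [->|[a0 Vb]]; first by left; rewrite mul0r.
  have [->|c0] := eqVneq (phi c) 0; first by left; rewrite mulr0.
  right; split; first by apply/eqP; rewrite mulf_neq0 //; apply/eqP.
  by rewrite -mulf_div divff ?mulr1.
- by rewrite pullback0 rmorph1; apply/eqP/oner_neq0.
Qed.

Lemma pullback_cancellation V : has_cancellation (pullback V).
Proof.
move=> a b c /pullback0/eqP c0; rewrite /pullback !rmorphM; case=> [/eqP|[/eqP]].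
  by rewrite mulf_eq0 (negPf c0) orbF => /eqP; left.
rewrite mulf_eq0 (negPf c0) orbF => /eqP a0 V'; right; split=> //.
by move: V'; rewrite -mulf_div divff ?mulr1.
Qed.

Lemma pullback_total V : valring V -> total_rel (pullback V).
Proof.
move=> [_ tV] a b; rewrite /pullback; have [|a0] := eqVneq (phi a) 0; first by right; left.
have [|b0] := eqVneq (phi b) 0; first by left; left.
have := tV (phi b / phi a); rewrite invf_div.
by case=> ?; [left|right]; right; split=> //; apply/eqP.
Qed.

Lemma pullback_pmul p V a : p%:R != 0 :> K -> ~ V p%:R^-1 ->
  ~ pullback V 0 a -> ~ pullback V (p%:R * a) a.
Proof.
move=> p0 nVp /pullback0 a0 [//|[_]]; rewrite rmorphM rmorph_nat invfM mulrCA.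
by rewrite divff ?mulr1 //; apply/eqP.
Qed.

Lemma pullback_in_SpecDp p V : prime p -> p_valring p V -> in_SpecDp p (pullback V).
Proof.
move=> pp pV; have [vV nVp _] := pV; have sV := vV.1; have p0 := valring_p_neq0 vV nVp.
split; [split|exact: pullback_total|exact: pullback_cancellation].
- exact: pullback_divisibility.
- by move=> a; apply: pullback_pmul.
(* Both sides of axiom (7) are homogeneous of the same degree: dividing by the square of
   [c = phi b ^ p.+1] leaves the claim that [u / (p (u ^ 2 - 1))] is in [V], where [u = t ^ p - t]
   and [t = phi a / phi b]. *)
move=> a b; have [b0|b0] := eqVneq (phi b) 0.
  by left; rewrite rmorphM rmorphXn b0 expr0n mulr0.
have Eu : phi (a ^+ p * b - b ^+ p * a) =
    ((phi a / phi b) ^+ p - phi a / phi b) * phi b ^+ p.+1.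
  by rewrite rmorphB !rmorphM !rmorphXn exprSr expr_div_n; field; rewrite b0 expf_neq0.
right; rewrite rmorphM rmorph_nat rmorphB rmorphXn !rmorphM Eu !rmorphXn.
set t := phi a / phi b; set u := t ^+ p - t; set c := phi b ^+ p.+1.
have c0 : c != 0 by rewrite expf_neq0.
have EL : p%:R * ((u * c) ^+ 2 - c ^+ 2) = p%:R * (u ^+ 2 - 1) * c ^+ 2 by ring.
suff [u0 Vu] : u ^+ 2 - 1 != 0 /\ V (u / (p%:R * (u ^+ 2 - 1))).
  rewrite EL; split; first by apply/eqP; rewrite !mulf_neq0 ?expf_neq0.
  by move: Vu; congr V; field; rewrite u0 p0 expf_neq0.
have Vx : V p%:R := subring_nat sV p.
(* For [t] in [V], Fermat gives [u = p * w], so [u ^ 2 - 1] is a unit and the quotient is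
   [w / (u ^ 2 - 1)]. *)
have [tV|tV] := pselect (V t).
  have Vw := p_valring_fermat pp pV tV; rewrite -/u in Vw; set w := u / p%:R in Vw.
  have uE : u = p%:R * w by rewrite /w; field.
  have [d0 Vd] := valring_unit_subM vV Vx nVp (subringM sV (subringM sV Vx Vw) Vw).
  have E : u ^+ 2 - 1 = - (1 - p%:R * (p%:R * w * w)) by rewrite uE; ring.
  rewrite E oppr_eq0; split=> //; set d := 1 - _ in d0 Vd *.
  have -> : u / (p%:R * - d) = - (w * d^-1) by rewrite /w; field; rewrite p0 oppr_eq0 d0.
  by apply: subringN => //; apply: subringM.
(* For [t] outside [V], so is [u]. Then [u^-1] is a nonunit, hence divisible by [p], and the
   quotient is [(u^-1 / p) / (1 - u^-1 * u^-1)]. *)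
have t0 : t != 0 by apply/eqP => t0; apply: tV; rewrite t0; apply: subring0.
have Vs : V t^-1 by case: (vV.2 t).
have nVu : ~ V u.
  move=> Vu; apply: tV; have pE : p = p.-2.+2 by have := prime_gt1 pp; lia.
  have -> : t = u * t^-1 ^+ p.-1 + t^-1 ^+ p.-2.
    rewrite /u {1}pE [in p.-1]pE /= !exprVn !exprS; field; rewrite t0 expf_neq0 //.
  by apply: subringD => //; [apply: subringM => //|]; apply: subringX.
have u0 : u != 0 by apply/eqP => u0; apply: nVu; rewrite u0; apply: subring0.
have Vu' : V u^-1 by case: (vV.2 u).
have nVu' : ~ V u^-1^-1 by rewrite invrK.
have [d0 Vd] := valring_unit_subM vV Vu' nVu' Vu'.
have E : u ^+ 2 - 1 = (1 - u^-1 * u^-1) * u ^+ 2 by field.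
rewrite E mulf_neq0 ?expf_neq0 //; split=> //; set d := 1 - _ in d0 Vd *.
have -> : u / (p%:R * (d * u ^+ 2)) = u^-1 / p%:R * d^-1 by field; rewrite p0 d0 u0.
by apply: subringM => //; apply: (p_valring_nonunit pp pV).
Qed.

End Pullback.

(** * The fraction field of a divisibility with cancellation *)

(* The units of a ring, chosen classically: [{fraction _}] and [divisibility] require a
   unit structure, which ideal quotients and subrings do not come with. *)
Definition with_units (R : comNzRingType) : Type := R.

Section WithUnits.
Variable R : comNzRingType.
HB.instance Definition _ := GRing.ComNzRing.on (with_units R).

Definition unit_with_units (x : with_units R) := `[< exists y, y * x = 1 >].
Definition inv_with_units (x : with_units R) :=
  if pselect (exists y, y * x = 1) is left e then projT1 (cid e) else x.

Fact mulVx_with_units :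
  {in unit_with_units, left_inverse 1 inv_with_units *%R}.
Proof.
by move=> x /asboolP ux; rewrite /inv_with_units; case: pselect => // e; case: cid.
Qed.

Fact unitPl_with_units (x y : with_units R) : y * x = 1 -> unit_with_units x.
Proof. by move=> yx; apply/asboolP; exists y. Qed.

Fact invr_out_with_units : {in [predC unit_with_units], inv_with_units =1 id}.
Proof.
by move=> x /asboolPn ux; rewrite /inv_with_units; case: pselect.
Qed.

HB.instance Definition _ := GRing.ComNzRing_hasMulInverse.Build (with_units R)
  mulVx_with_units unitPl_with_units invr_out_with_units.
End WithUnits.

Lemma fraction_numden (D : idomainType) (x : {fraction D}) :
  exists n d : D, d != 0 /\ x = FracField.tofrac n / FracField.tofrac d.
Proof.
elim/quotW: x => r; exists (frac r).1, (frac r).2; have r0 := denom_ratioP r.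
split=> //; apply: (canRL (mulfK _)); first by rewrite tofrac_eq0.
unlock FracField.tofrac; rewrite -[LHS]FracField.pi_mul; apply/eqmodP => /=.
rewrite FracField.equivfE /FracField.mulf !numden_Ratio ?mulf_neq0 ?oner_neq0 //.
by rewrite !mulr1 mulrC.
Qed.

(** [K] is the residue field at the prime ideal [I], that is, the fraction field of [R / I]. *)
Lemma prime_ideal_fraction (R : comNzRingType) (I : R -> Prop) :
  I 0 -> ~ I 1 -> (forall a u v, I u -> I v -> I (a * u + v)) ->
  (forall u v, I (u * v) -> I u \/ I v) ->
  exists (K : fieldType) (phi : {rmorphism R -> K}),
    (forall a, phi a = 0 <-> I a) /\
    (forall x, exists a b, phi b != 0 /\ x = phi a / phi b).
Proof.
move=> I0 I1 IM IP; pose S : {pred R} := fun x => `[< I x >].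
have SI : idealr_closed S.
  split; [exact/asboolP | exact/asboolPn | move=> a u v /asboolP Iu /asboolP Iv].
  exact/asboolP/IM.
have SP : prime_idealr_closed S.
  by move=> u v /asboolP/IP Iuv; apply/orP; case: Iuv => ?; [left|right]; exact/asboolP.
pose J : prime_idealr R := HB.pack S (isIdealr.Build R S SI) (isPrimeIdealrClosed.Build R S SP).
pose Q := with_units {ideal_quot J}.
have QP : GRing.integral_domain_axiom Q := @Quotient.rquot_IdomainAxiom R J.
pose D : idomainType := HB.pack Q (GRing.ComUnitRing_isIntegral.Build Q QP).
pose pi : {rmorphism R -> {ideal_quot J}} := \pi_({ideal_quot J})%qT.
pose tf : {rmorphism D -> {fraction D}} := @FracField.tofrac D.
have piE (a b : R) : (pi a == pi b) = (a - b \in J).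
  by rewrite Quotient.idealrBE.
pose phi0 (a : R) : {fraction D} := tf (pi a : D).
have phi0B : zmod_morphism phi0.
  by move=> a b; rewrite /phi0 rmorphB; exact: (rmorphB tf).
have phi0M : monoid_morphism phi0.
  split; first by rewrite /phi0 rmorph1; exact: (rmorph1 tf).
  by move=> a b; rewrite /phi0 rmorphM; exact: (rmorphM tf).
pose phi : {rmorphism R -> {fraction D}} := HB.pack phi0
  (GRing.isZmodMorphism.Build R {fraction D} phi0 phi0B)
  (GRing.isMonoidMorphism.Build R {fraction D} phi0 phi0M).
exists {fraction D}, phi; split=> [a|x].
  rewrite (rwP eqP) [phi a == 0](tofrac_eq0 (pi a : D)) -[0 : D](rmorph0 pi) piE subr0.
  by split=> /asboolP.
have [n [d [d0 ->]]] := fraction_numden x.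
have [a an] : exists a, pi a = n by exists (repr (n : {ideal_quot J})); exact: reprK.
have [b bd] : exists b, pi b = d by exists (repr (d : {ideal_quot J})); exact: reprK.
by exists a, b; rewrite /phi /= /phi0 an bd tofrac_eq0.
Qed.

(** Cancellation serves twice: it makes the ideal of elements divisible by 0 prime, and it makes
    [d b a], for [phi b != 0], depend only on the fraction [phi a / phi b]. *)
Lemma divisibility_fraction (A : comUnitRingType) (d : A -> A -> Prop) :
  divisibility d -> has_cancellation d ->
  exists (K : fieldType) (phi : {rmorphism A -> K}) (O : K -> Prop),
    [/\ subring O, forall a b, d a b <-> pullback phi O a b &
        forall x, exists a b, phi b != 0 /\ x = phi a / phi b].
Proof.
move=> [dxx dtr dB dM d01] dC.
have d0 a : d a 0 by rewrite -(subrr a); apply: dB.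
have dN a b : d a b -> d a (- b) by move=> ?; rewrite -sub0r; apply: dB.
have dD a b c : d a b -> d a c -> d a (b + c).
  by move=> ? ?; rewrite -[c]opprK; apply: dB => //; apply: dN.
have dMl a b c : d a b -> d (c * a) (c * b) by rewrite ![c * _]mulrC; apply: dM.
have [||||K [phi [phi0 phiS]]] := @prime_ideal_fraction A (d 0) => //.
- by move=> a u v du dv; apply: dD => //; have := dMl _ _ a du; rewrite mulr0.
- move=> u v duv; have [|du] := pselect (d 0 v); [by right|left].
  by apply: (dC _ _ v) => //; rewrite mul0r.
pose O x := exists a b, [/\ phi b != 0, x = phi a / phi b & d b a].
have OP a b : phi b != 0 -> O (phi a / phi b) <-> d b a.
  move=> b0; split=> [[a' [b' [b0' e dba]]]|dba]; last by exists a, b.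
  have {}e : phi (a * b' - a' * b) = 0.
    by rewrite rmorphB !rmorphM; apply/eqP; rewrite subr_eq0 -eqr_div // e.
  apply: (dC _ _ b'); first by move/phi0/eqP; apply/negP.
  rewrite -(subrK (a' * b) (a * b')); apply: dD.
    by apply: dtr (d0 _) _; apply/phi0.
  by rewrite mulrC; apply: dM.
exists K, phi, O; split=> //.
- split.
  + by exists 1, 1; rewrite rmorph1 divr1 oner_neq0.
  + move=> _ _ [a [b [b0 -> dba]]] [a' [b' [b0' -> dba']]].
    exists (a * b' - a' * b), (b * b'); split.
    * by rewrite rmorphM mulf_neq0.
    * by rewrite rmorphB !rmorphM; field; rewrite b0 b0'.
    * by apply: dB; [apply: dM|rewrite mulrC; apply: dM].
  + move=> _ _ [a [b [b0 -> dba]]] [a' [b' [b0' -> dba']]].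
    exists (a * a'), (b * b'); split.
    * by rewrite rmorphM mulf_neq0.
    * by rewrite !rmorphM mulf_div.
    * by apply: dtr (dM _ _ b' dba) _; apply: dMl.
- move=> a b; rewrite /pullback; split=> [dab|[/phi0 ?|[/eqP a0]]].
  + have [|b0] := eqVneq (phi b) 0; [by left|right].
    have a0 : phi a != 0.
      by apply: contra b0 => /eqP/phi0 da; apply/eqP/phi0; apply: dtr dab.
    by split; [exact/eqP|exact/OP].
  + exact: dtr (d0 a) _.
  + by move/OP; apply.
Qed.

(** * Axiom (7) and the residue field *)

Lemma pullback_p_nonunit p (A : comUnitRingType) (d : A -> A -> Prop)
    (K : fieldType) (phi : {rmorphism A -> K}) (O : K -> Prop) :
  (p%:R : A) \is a GRing.unit -> p_divisibility p d ->
  (forall a b, d a b <-> pullback phi O a b) -> ~ O p%:R^-1.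
Proof.
move=> pU [[_ _ _ _ d01] dp _] dO Op; apply: (dp 1 d01); apply/dO.
right; rewrite mulr1 rmorph1 div1r rmorph_nat; split=> //; apply/eqP.
by rewrite -(rmorph_nat phi) -unitfE rmorph_unit.
Qed.

(* By axiom (7), [u / (p (u ^ 2 - 1))] lies in [O] for [u = t ^ p - t]. *)
Lemma pullback_kochen p (A : comUnitRingType) (d : A -> A -> Prop)
    (K : fieldType) (phi : {rmorphism A -> K}) (O V : K -> Prop) :
  (p%:R : A) \is a GRing.unit -> p_divisibility p d -> has_cancellation d ->
  (forall a b, d a b <-> pullback phi O a b) ->
  (forall x, exists a b, phi b != 0 /\ x = phi a / phi b) ->
  subring V -> (forall x, O x -> V x) ->
  forall t, V t -> V ((t ^+ p - t) / p%:R).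
Proof.
move=> pU [[dxx dtr dB dM d01] dp d7] dC dO phiS sV OV t Vt.
have p0 : p%:R != 0 :> K by rewrite -(rmorph_nat phi) -unitfE rmorph_unit.
have [a [b [b0 tE]]] := phiS t; have := d7 a b; move/dO.
have Eu : phi (a ^+ p * b - b ^+ p * a) = (t ^+ p - t) * phi b ^+ p.+1.
  by rewrite tE rmorphB !rmorphM !rmorphXn exprSr expr_div_n; field; rewrite b0 expf_neq0.
move: (_ - _) Eu => w Eu.
rewrite /pullback !rmorphM rmorph_nat rmorphB !rmorphXn Eu; clear w Eu.
set u := t ^+ p - t; set c := phi b ^+ p.+1.
have c0 : c != 0 by rewrite expf_neq0.
have Vu : V u by apply: subringB => //; apply: subringX.
have [->|u0] := eqVneq u 0; first by move=> _; rewrite mul0r; exact: (subring0 sV).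
case=> [/eqP|[/eqP e0 /OV Vq]]; first by rewrite !mulf_eq0 (negPf u0) (negPf c0).
have EL : p%:R * ((u * c) ^+ 2 - c ^+ 2) = p%:R * (u ^+ 2 - 1) * c ^+ 2 by ring.
have d0 : u ^+ 2 - 1 != 0 by apply: contra e0; rewrite EL => /eqP ->; rewrite mulr0 mul0r.
(* Multiplication by [u ^ 2 - 1], an element of [V], turns the Kochen quotient into [u / p]. *)
have -> : u / p%:R = u * c * c / (p%:R * ((u * c) ^+ 2 - c ^+ 2)) * (u ^+ 2 - 1).
  by rewrite EL; field; rewrite p0 d0 c0.
by apply: subringM => //; apply: subringB => //; [apply: subringX|apply: subring1].
Qed.

(** Over ['F_p] the product of the ['X - i] is ['X^p - 'X], so [p] divides every coefficient of the
    difference of the two integer polynomials; [q] is the quotient. *)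
Lemma prod_sub_nat p (R : comNzRingType) (x : R) : prime p ->
  exists q : {poly int},
    \prod_(0 <= i < p) (x - i%:R) = x ^+ p - x + p%:R * (map_poly intr q).[x].
Proof.
move=> pp; pose P : {poly int} := \prod_(0 <= i < p) ('X - i%:R%:P) - ('X^p - 'X).
have P0 : map_poly intr P = 0 :> {poly 'F_p}.
  rewrite rmorphB rmorph_prod /= rmorphB /= map_polyXn map_polyX.
  have -> : 'X^p - 'X = \prod_(i : 'F_p) ('X - i%:P) :> {poly 'F_p}.
    by rewrite -finField_genPoly card_Fp.
  rewrite -[index_iota 0 p](congr1 (index_iota 0) (Fp_cast pp)) big_mkord.
  apply/eqP; rewrite subr_eq0; apply/eqP.
  by apply: eq_bigr => i _; rewrite rmorphB /= map_polyX map_polyC /= rmorph_nat natr_Zp.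
have Pp i : (p %| P`_i)%Z.
  by rewrite (dvdz_pcharf (pchar_Fp pp)) -coef_map P0 coef0.
exists (\poly_(i < size P) (P`_i %/ p)%Z).
have PE : P = p%:R *: \poly_(i < size P) (P`_i %/ p)%Z.
  apply/polyP => i; rewrite coefZ coef_poly; case: ltnP => iP.
    by rewrite mulrC natz divzK.
  by rewrite mulr0 nth_default.
have := congr1 (fun P => (map_poly intr P : {poly R}).[x]) PE.
rewrite /= map_polyZ hornerZ rmorph_nat => <-.
rewrite /P !rmorphB /= rmorph_prod /= map_polyXn map_polyX.
rewrite !(hornerD, hornerN) hornerXn hornerX [RHS]addrC subrK.
rewrite horner_prod; apply: eq_bigr => i _.
by rewrite rmorphB /= map_polyX map_polyC /= rmorph_nat !hornerE.
Qed.

(** The product of the [x - i], [i < p], lies in [p V]. If no single factor did, all of them would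
    be units of [V], and [1 / p] would be in [V]. *)
Lemma fermat_p_valring p (K : fieldType) (V : K -> Prop) : prime p -> valring V ->
  ~ V p%:R^-1 -> (forall t, V t -> V ((t ^+ p - t) / p%:R)) -> p_valring p V.
Proof.
move=> pp vV nVp VF; have sV := vV.1; split=> // x Vx.
have p0 : p%:R != 0 :> K by apply/eqP => p0; apply: nVp; rewrite p0 invr0; exact: (subring0 sV).
(* For a nonunit [t], the element [t - t ^ p] of [p V] is [t] times the unit [1 - t ^ p.-1]. *)
have nonunit t : V t -> ~ V t^-1 -> V (t / p%:R).
  move=> Vt nVt; have pE : p = p.-2.+2 by have := prime_gt1 pp; lia.
  have [c0 Vc] := valring_unit_subM vV Vt nVt (subringX sV p.-2 Vt).
  have -> : t / p%:R = - ((t ^+ p - t) / p%:R * (1 - t * t ^+ p.-2)^-1).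
    rewrite [t ^+ p](_ : _ = t * t * t ^+ p.-2); last by rewrite {1}pE !exprS mulrA.
    by field; rewrite p0 c0.
  by apply: subringN => //; apply: subringM => //; apply: VF.
have [q qE] := prod_sub_nat x pp.
have Vq : V (\prod_(0 <= i < p) (x - i%:R) / p%:R).
  rewrite qE mulrDl mulrAC divff // mul1r; apply: subringD => //; first exact: VF.
  rewrite horner_coef; apply: subring_sum => // i _; apply: subringM => //; last exact: subringX.
  by rewrite coef_map; apply: subring_int.
have [[i Vi]|nex] := pselect (exists i : nat, V ((x - i%:R) / p%:R)).
  by exists (i : int).
have VB i : V (x - i%:R) by apply: subringB => //; apply: subring_nat.
have VI i : V (x - i%:R)^-1.
  by have [//|nV] := pselect (V (x - i%:R)^-1); case: nex; exists i; apply: nonunit.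
have x0 i : x - i%:R != 0.
  by apply/eqP => e; apply: nex; exists i; rewrite e mul0r; exact: (subring0 sV).
case: nVp; have -> : p%:R^-1 = \prod_(0 <= i < p) (x - i%:R) / p%:R *
    \prod_(0 <= i < p) (x - i%:R)^-1 :> K.
  have P0 : \prod_(0 <= i < p) (x - i%:R) != 0.
    by rewrite prodf_seq_neq0; apply/allP => i _; rewrite x0.
  by rewrite prodfV; field; rewrite p0 P0.
by apply: subringM => //; apply: subring_prod.
Qed.

Lemma pullback_valring (A : comUnitRingType) (d : A -> A -> Prop)
    (K : fieldType) (phi : {rmorphism A -> K}) (O : K -> Prop) :
  total_rel d -> subring O -> (forall a b, d a b <-> pullback phi O a b) ->
  (forall x, exists a b, phi b != 0 /\ x = phi a / phi b) -> valring O.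
Proof.
move=> dt sO dO phiS; split=> // x; have [a [b [b0 ->]]] := phiS x; rewrite invf_div.
have [a0|a0] := eqVneq (phi a) 0; first by left; rewrite a0 mul0r; exact: subring0.
have [/dO|/dO] := dt b a; case=> [/eqP|[_ ?]]; [|by left| |by right].
  by rewrite (negPf a0).
by rewrite (negPf b0).
Qed.

(** * Maximal p-divisibilities *)

Section MaximalSubring.
Variables (K : fieldType) (O : K -> Prop) (pi : K).
Hypotheses (sO : subring O) (Opi : O pi) (nOpi : ~ O pi^-1).
Hypothesis maxO :
  forall V : K -> Prop, subring V -> (forall x, O x -> V x) -> ~ V pi^-1 ->
  forall x, V x -> O x.

Let pi0 : pi != 0.
Proof. by apply/eqP => p0; apply: nOpi; rewrite p0 invr0; exact: (subring0 sO). Qed.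

(** Powers of [c = 1 - pi * a] stay congruent to 1 modulo [pi], so inverting [c] does not bring in
    [pi^-1], and by maximality the localization is [O] itself. *)
Let maximal_subring_unit a : O a -> O (1 - pi * a)^-1.
Proof.
move=> Oa; set c := 1 - pi * a.
have Oc : O c by apply: subringB => //; [apply: subring1|apply: subringM].
have OX k x : O x -> O (x * c ^+ k) by move=> Ox; apply: subringM => //; apply: subringX.
have cX k : exists2 y, O y & c ^+ k = 1 - pi * y.
  elim: k => [|k [y Oy cE]]; first by exists 0; [exact: subring0|rewrite mulr0 subr0].
  exists (a + y * c); last by rewrite exprSr cE /c; ring.
  by apply: subringD => //; apply: subringM.
apply: (@maxO (fun x => exists k, O (x * c ^+ k))).
- split.
  + by exists 0; rewrite mulr1; apply: subring1.
  + move=> x y [k Ox] [l Oy]; exists (k + l)%N.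
    have -> : (x - y) * c ^+ (k + l) = x * c ^+ k * c ^+ l - y * c ^+ l * c ^+ k.
      by rewrite exprD; ring.
    by apply: subringB => //; apply: OX.
  + move=> x y [k Ox] [l Oy]; exists (k + l)%N.
    have -> : x * y * c ^+ (k + l) = x * c ^+ k * (y * c ^+ l) by rewrite exprD; ring.
    exact: subringM.
- by move=> x Ox; exists 0; rewrite mulr1.
- move=> [k]; have [y Oy ->] := cX k; rewrite mulrBr mulr1 mulKf // => Oq.
  by apply: nOpi; rewrite -(subrK y pi^-1); apply: subringD.
have [->|c0] := eqVneq c 0; exists 1%N; rewrite expr1.
  by rewrite invr0 mul0r; apply: subring0.
by rewrite mulVf //; apply: subring1.
Qed.

(** An expression of [pi^-1] as a polynomial in [z] over [O] of degree less than [n], as in the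
    proof of Chevalley's extension theorem. *)
Let rel n z := exists f : nat -> K, (forall i, O (f i)) /\ pi^-1 = \sum_(i < n) f i * z ^+ i.

Let rel_widen m n z : (m <= n)%N -> rel m z -> rel n z.
Proof.
move=> mn [f [Of fE]]; exists (fun i => if (i < m)%N then f i else 0); split.
  by move=> i; case: ifP => // _; apply: subring0.
rewrite fE (big_ord_widen _ (fun i => f i * z ^+ i) mn) big_mkcond.
by apply: eq_bigr => i _; case: ifP; rewrite ?mul0r.
Qed.

(** Otherwise [O[z]] would avoid [pi^-1], and maximality would put [z] in [O]. *)
Let rel_adjoin z : ~ O z -> exists n, rel n z.
Proof.
move=> nOz; pose V x := exists f : {poly K}, (forall i, O f`_i) /\ x = f.[z].
have [[f [Of fE]]|nV] := pselect (V pi^-1).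
  by exists (size f), (fun i => f`_i); rewrite fE horner_coef.
case: nOz; apply: (maxO (V := V)) => //.
- split.
  + exists 1; rewrite hornerC; split=> // i; rewrite coef1.
    by case: eqP => _; [apply: subring1|apply: subring0].
  + move=> _ _ [f [Of ->]] [g [Og ->]]; exists (f - g); rewrite hornerD hornerN; split=> // i.
    by rewrite coefB; apply: subringB.
  + move=> _ _ [f [Of ->]] [g [Og ->]]; exists (f * g); rewrite hornerM; split=> // i.
    by rewrite coefM; apply: subring_sum => // j _; apply: subringM.
- move=> x Ox; exists x%:P; rewrite hornerC; split=> // i; rewrite coefC.
  by case: eqP => // _; apply: subring0.
- exists 'X; rewrite hornerX; split=> // i; rewrite coefX.
  by case: eqP => _; [apply: subring1|apply: subring0].
Qed.

(* The relation for [z^-1] expresses [z ^ n], hence the leading term of the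
   relation for [z], by lower powers of [z]. *)
Let rel_descent n z : z != 0 -> rel n.+1 z -> rel n.+1 z^-1 -> rel n z.
Proof.
move=> z0 [f [Of fE]] [g [Og gE]].
have c0 : 1 - pi * g 0%N != 0.
  apply/eqP => /eqP; rewrite subr_eq0 => /eqP e; apply: nOpi.
  by rewrite -[pi^-1]mulr1 e mulKf.
have Oc := maximal_subring_unit (Og 0%N); set c := 1 - pi * g 0%N in c0 Oc.
exists (fun i => f i + f n * (pi * c^-1 * g (n - i)%N)); split.
  by move=> i; apply: subringD => //; do ?apply: subringM => //.
have S : \sum_(i < n) g (n - i)%N * z ^+ i = z ^+ n * (pi^-1 - g 0%N).
  rewrite gE big_ord_recl /= mulr1 addrC addKr mulr_sumr (reindex_inj rev_ord_inj) /=.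
  apply: eq_bigr => i _; rewrite subKn ?ltn_ord // mulrCA; congr (_ * _).
  rewrite /bump /= add1n exprVn -expfB_cond ?(negPf z0) //.
  by have := ltn_ord i; lia.
under eq_bigr do rewrite mulrDl -!mulrA.
rewrite big_split /= -!mulr_sumr S; move: fE; rewrite big_ord_recr /= => fE.
by rewrite {1}fE; congr (_ + _); rewrite /c in c0 *; field; rewrite pi0.
Qed.

(** If neither [z] nor [z^-1] were in [O], both would satisfy relations. Once these have equal
    length, each shortens the other, down to [pi^-1] being an empty sum. *)
Lemma maximal_subring_valring : valring O.
Proof.
split=> // z; have [|nOz] := pselect (O z); [by left|right].
have [//|nOz'] := pselect (O z^-1); exfalso.
have z0 : z != 0 by apply/eqP => z0; apply: nOz; rewrite z0; exact: (subring0 sO).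
have [n1 r1] := rel_adjoin nOz; have [n2 r2] := rel_adjoin nOz'.
have {}r1 : rel (n1 + n2) z by apply: rel_widen r1; apply: leq_addr.
have {}r2 : rel (n1 + n2) z^-1 by apply: rel_widen r2; apply: leq_addl.
elim: (n1 + n2)%N r1 r2 => [|n IHn] r1 r2.
  by case: r1 => f [_]; rewrite big_ord0 => e; apply: nOpi; rewrite e; exact: (subring0 sO).
by apply: IHn; apply: rel_descent; rewrite ?invr_eq0 ?invrK.
Qed.

End MaximalSubring.

(** Zorn's lemma: in the union of a chain two premises already hold in a common member, and the
    negative axioms are tested in one member at a time; [d0] bounds the empty chain. *)
Lemma maximal_p_divisibility p (A : comUnitRingType) (d0 : A -> A -> Prop) :
  p_divisibility p d0 ->
  exists d : A -> A -> Prop, p_divisibility p d /\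
    forall e : A -> A -> Prop, p_divisibility p e ->
      (forall a b, d a b -> e a b) -> forall a b, e a b -> d a b.
Proof.
move=> d0P; pose T := {d : A -> A -> Prop | p_divisibility p d}.
pose R (s t : T) := `[< forall a b, sval s a b -> sval t a b >].
have [| | |C Ctot|[d dP] dmax] := @classical_sets.Zorn T R.
- by move=> s; apply/asboolP.
- by move=> r s t /asboolP rs /asboolP st; apply/asboolP => a b /rs/st.
- move=> [s sP] [t tP] /asboolP /= st /asboolP /= ts; apply: eq_exist.
  by apply/funext => a; apply/funext => b; apply/propext; split=> [/st|/ts].
- have [[s0 Cs0]|C0] := pselect (exists s, C s); last first.
    by exists (exist _ d0 d0P) => s Cs; case: C0; exists s.
  pose u a b := exists2 s, C s & sval s a b.
  have u2 a b a' b' : u a b -> u a' b' -> exists s, [/\ C s, sval s a b & sval s a' b'].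
    move=> [s Cs sab] [t Ct tab']; have [/asboolP st|/asboolP ts] := Ctot _ _ Cs Ct.
      by exists t; split=> //; apply: st.
    by exists s; split=> //; apply: ts.
  have uP : p_divisibility p u.
    split; [split|..].
    + by move=> a; exists s0 => //; case: (svalP s0) => -[].
    + move=> a b c ab bc; have [s [Cs sab sbc]] := u2 _ _ _ _ ab bc.
      by exists s => //; case: (svalP s) => -[_ tr _ _ _] _ _; apply: tr sbc.
    + move=> a b c ab bc; have [s [Cs sab sac]] := u2 _ _ _ _ ab bc.
      by exists s => //; case: (svalP s) => -[_ _ + _ _] _ _; apply.
    + move=> a b c [s Cs sab]; exists s => //.
      by case: (svalP s) => -[_ _ _ + _] _ _; apply.
    + by move=> [s Cs]; case: (svalP s) => -[].
    + move=> a na [s Cs spa]; case: (svalP s) => _ /(_ a) + _; apply=> // sa.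
      by apply: na; exists s.
    + by move=> a b; exists s0 => //; case: (svalP s0).
  by exists (exist _ u uP) => s Cs; apply/asboolP => a b sab; exists s.
exists d; split=> // e eP de a b.
have /(congr1 sval) /= -> // : exist _ e eP = exist _ d dP :> T.
by apply: dmax; apply/asboolP.
Qed.

Lemma p_divisibility_p_valring p (A : comUnitRingType) (d0 : A -> A -> Prop) :
  prime p -> (p%:R : A) \is a GRing.unit -> p_divisibility p d0 ->
  exists (K : fieldType) (phi : {rmorphism A -> K}) (V : K -> Prop), p_valring p V.
Proof.
move=> pp pU /maximal_p_divisibility[d [dP dmax]].
(* For [c] not divisible by 0, the relation [d (a * c) (b * c)] between [a] and [b] is a
   p-divisibility containing [d], so maximality makes it equal to [d]. *)
have dC : has_cancellation d.
  move=> a b c nc; apply: (dmax (fun a b => d (a * c) (b * c))); last first.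
    by move=> x y; case: dP => -[_ _ _ + _] _ _; apply.
  case: dP => -[dxx dtr dB dM d01] dp d7; split; [split|..] => //.
  - by move=> ? ? ?; apply: dtr.
  - by move=> x y z; rewrite mulrBl; apply: dB.
  - by move=> x y z ?; rewrite ![_ * z * c]mulrAC; apply: dM.
  - by rewrite mul0r mul1r.
  - by move=> x; rewrite mul0r -mulrA => ?; apply: dp.
  - by move=> x y; apply: dM.
have dD : divisibility d by case: dP.
have [K [phi [O [sO dO phiS]]]] := divisibility_fraction dD dC.
have nOp := pullback_p_nonunit pU dP dO.
have p0 : p%:R != 0 :> K by rewrite -(rmorph_nat phi) -unitfE rmorph_unit.
exists K, phi, O; apply: fermat_p_valring => //; last first.
  exact: (pullback_kochen pU dP dC dO phiS sO).
apply: (@maximal_subring_valring _ _ p%:R) => //; first exact: subring_nat.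
(* An overring [V] of [O] without [1 / p] pulls back to a relation containing [d], which therefore
   inherits axiom (7); maximality of [d] then puts [V] inside [O]. *)
move=> V sV OV nVp x Vx; have [a [b [b0 xE]]] := phiS x.
have db : d b a.
  apply: (dmax (pullback phi V)).
  - split; first exact: pullback_divisibility.
    + by move=> c; apply: pullback_pmul.
    + move=> r s; case: dP => _ _ /(_ r s) /dO[|[? /OV ?]]; [by left|by right].
  - by move=> r s /dO[|[? /OV ?]]; [left|right].
  - by right; rewrite -xE; split=> //; apply/eqP.
move/dO: db => [a0|[_]]; last by rewrite -xE.
by rewrite xE a0 mul0r; apply: subring0.
Qed.

(** * Valuations and valuation rings *)

Section ValuationTheory.
Variables (K : fieldType) (G : zmodType) (le : G -> G -> Prop) (v : K -> option G).
Hypothesis vP : valuation le v.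

Let leG : ordered_group le. Proof. by case: vP. Qed.

Lemma valuation0 : v 0 = None.
Proof. by case: vP => _ v0 _ _; apply/v0. Qed.

Lemma valuation_Some x : x != 0 -> exists g, v x = Some g.
Proof.
case: vP => _ v0 _ _ x0; case E: (v x) => [g|]; first by exists g.
by move/v0: E x0 => ->; rewrite eqxx.
Qed.

Lemma valuationM x y g h : v x = Some g -> v y = Some h -> v (x * y) = Some (g + h).
Proof. by case: vP => _ _ vM _ vx vy; rewrite vM vx vy. Qed.

Lemma valuation1 : v 1 = Some 0.
Proof.
have [g v1] := valuation_Some (oner_neq0 K); have := valuationM v1 v1.
rewrite mulr1 v1 => -[gg]; congr Some.
by apply: (addrI g); rewrite addr0 -gg.
Qed.

Lemma valuationV x g : v x = Some g -> v x^-1 = Some (- g).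
Proof.
move=> vx; have x0 : x != 0 by apply/eqP => x0; move: vx; rewrite x0 valuation0.
have [h vh] : exists h, v x^-1 = Some h by apply: valuation_Some; rewrite invr_eq0.
have := valuationM vx vh; rewrite divff // valuation1 vh => -[] /esym/eqP.
by rewrite addrC addr_eq0 => /eqP ->.
Qed.

Lemma valuation_div x y g h : v x = Some g -> v y = Some h ->
  le g h <-> ole le (Some 0) (v (y / x)).
Proof.
move=> vx vy; rewrite (valuationM vy (valuationV vx)) /=.
case: leG => _ _ _ _ leD; split=> [/(leD _ _ (- g))|/(leD _ _ g)].
  by rewrite subrr.
by rewrite subrK add0r.
Qed.

(** The value of [-1] is killed by 2, and an ordered group has no torsion. *)
Let valuationN1 : v (- 1) = Some 0.
Proof.
have n0 : - 1 != 0 :> K by rewrite oppr_eq0 oner_neq0.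
have [g vg] := valuation_Some n0; have := valuationM vg vg.
rewrite mulrNN mulr1 valuation1 vg => -[] gg.
case: leG => _ anti _ tot leD; congr Some; case: (tot g 0) => g0.
  by apply: anti => //; have := leD _ _ g g0; rewrite -gg add0r.
by apply: anti => //; have := leD _ _ g g0; rewrite -gg add0r.
Qed.

Let valuationN x : v (- x) = v x.
Proof.
have [->|x0] := eqVneq x 0; first by rewrite oppr0.
have [g vx] := valuation_Some x0.
by rewrite -mulN1r (valuationM valuationN1 vx) add0r vx.
Qed.

Lemma valuation_valring : valring (fun x => ole le (Some 0) (v x)).
Proof.
case: vP leG => _ _ vM vD [refl anti trans tot leD].
have otr a b : ole le (Some 0) a -> ole le a b -> ole le (Some 0) b.
  by case: a b => [a|] [b|] //=; apply: trans.
split; first split.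
- by rewrite valuation1; apply: refl.
- move=> x y Vx Vy; case: (vD x (- y)); apply: otr => //; by rewrite valuationN.
- move=> x y; rewrite vM; case: (v x) (v y) => [a|] [b|] //= a0 b0.
  by apply: trans b0 _; have := leD _ _ b a0; rewrite add0r.
- move=> x; have [->|x0] := eqVneq x 0; first by rewrite invr0 valuation0; left.
  have [g vx] := valuation_Some x0; rewrite vx (valuationV vx) /=.
  case: (tot 0 g) => [|/(leD _ _ (- g))]; [by left|].
  by rewrite subrr add0r; right.
Qed.

End ValuationTheory.

(** * The value group of a valuation ring *)

Definition nonzero (K : fieldType) : Type := {x : K | x != 0}.

Section Nonzero.
Variable K : fieldType.
HB.instance Definition _ := Choice.copy (nonzero K) {x : K | x != 0}.
Implicit Types x y z : nonzero K.

Definition nonzero_one : nonzero K := exist _ 1 (oner_neq0 K).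
Definition nonzero_mul x y : nonzero K := exist _ (val x * val y) (mulf_neq0 (valP x) (valP y)).
Definition nonzero_inv x : nonzero K := exist _ (val x)^-1 (invr_neq0 (valP x)).

Fact nonzero_mulA : associative nonzero_mul.
Proof. by move=> x y z; apply: val_inj; rewrite /= mulrA. Qed.
Fact nonzero_mulC : commutative nonzero_mul.
Proof. by move=> x y; apply: val_inj; rewrite /= mulrC. Qed.
Fact nonzero_mul1 : left_id nonzero_one nonzero_mul.
Proof. by move=> x; apply: val_inj; rewrite /= mul1r. Qed.
Fact nonzero_mulV : left_inverse nonzero_one nonzero_inv nonzero_mul.
Proof. by move=> x; apply: val_inj; rewrite /= mulVf ?(valP x). Qed.

(* The multiplicative group of K, written additively. *)
HB.instance Definition _ := GRing.isZmodule.Build (nonzero K)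
  nonzero_mulA nonzero_mulC nonzero_mul1 nonzero_mulV.
End Nonzero.

(** The value group is [nonzero K] modulo the units of [V], the class of [x] being below that of [y]
    when [y / x] is in [V]. *)
Lemma valring_valuation (K : fieldType) (V : K -> Prop) : valring V ->
  exists (G : zmodType) (le : G -> G -> Prop) (v : K -> option G),
    valuation le v /\ forall x, V x <-> ole le (Some 0) (v x).
Proof.
move=> [sV tV].
have V1 := subring1 sV; have VM := subringM sV.
pose U : {pred nonzero K} := fun x => `[< V (val x) /\ V (val x)^-1 >].
have UP : zmod_closed U.
  split=> [|x y /asboolP[Vx Vx'] /asboolP[Vy Vy']]; apply/asboolP.
    by rewrite /= invr1.
  by rewrite /= invfM invrK; split; apply: VM.
pose J : zmodClosed (nonzero K) := HB.pack U (GRing.isZmodClosed.Build _ U UP).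
pose G := Quotient.quot J.
pose pi : {additive nonzero K -> G} := \pi_G%qT.
have piD x y : pi (x + y) = pi x + pi y by exact: raddfD.
have piS g : exists x, g = pi x by exists (repr g); exact: esym (reprK g).
have piP x y : pi x = pi y <-> U (x - y).
  by split=> [/eqP|Uxy]; [|apply/eqP]; rewrite -[_ == _]Quotient.idealrBE.
have piV x y : pi x = pi y -> V (val x / val y) by move/piP/asboolP => [].
have val0 (x : nonzero K) : val x != 0 by exact: (valP x).
have valD (x y : nonzero K) : val (x + y) = val x * val y by [].
pose le (g h : G) := exists x y, [/\ g = pi x, h = pi y & V (val y / val x)].
have leE x y : le (pi x) (pi y) <-> V (val y / val x).
  split=> [[x' [y' [/esym/piV Vx /piV Vy Vxy]]]|]; last by exists x, y.
  have -> : val y / val x = val y / val y' * (val y' / val x') * (val x' / val x).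
    by field; rewrite !val0.
  by apply: (VM) => //; apply: (VM).
pose v (x : K) : option G := omap pi (insub x).
have vE x (x0 : x != 0) : v x = Some (pi (exist _ x x0)) by rewrite /v insubT.
have v0 : v 0 = None by rewrite /v insubF ?eqxx.
have one_pi : 0 = pi 0 by rewrite raddf0.
have vV x : V x <-> ole le (Some 0) (v x).
  have [->|x0] := eqVneq x 0; first by rewrite v0; split=> // _; apply: subring0.
  by rewrite (vE _ x0) one_pi /= leE /= divr1.
exists G, le, v; split=> //; split.
- split.
  + by move=> g; have [x ->] := piS g; rewrite leE divff.
  + move=> g h; have [x ->] := piS g; have [y ->] := piS h; rewrite !leE => Vyx Vxy.
    by apply/piP/asboolP; rewrite /= invfM invrK [_ * val y]mulrC.
  + move=> g h k; have [x ->] := piS g; have [y ->] := piS h; have [z ->] := piS k.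
    rewrite !leE => Vyx Vzy; have -> : val z / val x = val z / val y * (val y / val x).
      by field; rewrite !val0.
    exact: VM.
  + move=> g h; have [x ->] := piS g; have [y ->] := piS h; rewrite !leE.
    by have := tV (val y / val x); rewrite invf_div => -[]; [left|right].
  + move=> g h k; have [x ->] := piS g; have [y ->] := piS h; have [z ->] := piS k.
    by rewrite -!piD !leE !valD -mulf_div divff ?mulr1.
- move=> x; have [->|x0] := eqVneq x 0; first by rewrite v0.
  by rewrite (vE _ x0); split=> // x0'; have := x0; rewrite {1}x0' eqxx.
- move=> x y; have [->|x0] := eqVneq x 0; first by rewrite mul0r v0.
  have [->|y0] := eqVneq y 0; first by rewrite mulr0 v0 (vE _ x0).
  rewrite (vE _ x0) (vE _ y0) (vE _ (mulf_neq0 x0 y0)) /= -piD; congr (Some (pi _)).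
  exact: val_inj.
move=> x y; have [->|x0] := eqVneq x 0; first by right; rewrite add0r; case: (v y) => [g|] //=;
  have [z ->] := piS g; rewrite leE divff.
have [->|y0] := eqVneq y 0; first by left; rewrite addr0 (vE _ x0) /= leE divff.
have [e|s0] := eqVneq (x + y) 0; first by left; rewrite e v0 (vE _ x0).
rewrite (vE _ x0) (vE _ y0) (vE _ s0) /= !leE /=.
have V1D z : V z -> V (1 + z) by apply: subringD.
(* One of [y / x] and [x / y] is in [V]; adding 1 gives [(x + y) / x] or [(x + y) / y]. *)
have := tV (y / x); rewrite invf_div => -[/V1D Vxy|/V1D Vxy]; [left|right];
  by move: Vxy; congr V; field.
Qed.

(** Residues are read off integer digits: [x] goes to the class of any [z] with [x - z] in [p V],
    and two such digits agree modulo [p]. *)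
Lemma p_valring_p_valuation p (K : fieldType) (V : K -> Prop) :
  prime p -> p_valring p V ->
  exists (G : zmodType) (le : G -> G -> Prop) (v : K -> option G), p_valuation p le v.
Proof.
move=> pp pV; have [vV nVp digit] := pV; have [sV tV] := vV.
have [G [le [v [vP VE]]]] := valring_valuation vV; exists G, le, v.
have p0 := valring_p_neq0 vV nVp.
have [[_ anti _ _ leD] _ _ _] := vP.
have v0 x : V x -> V x^-1 -> x != 0 -> v x = Some 0.
  move=> /VE Vx /VE Vx' x0; have [g vx] := valuation_Some vP x0.
  move: Vx Vx'; rewrite (valuationV vP vx) vx /= => g0 /(leD _ _ g).
  by rewrite add0r addNr => g0'; rewrite (anti _ _ g0' g0).
have nu x : V x -> v x <> Some 0 -> V (x / p%:R).
  move=> Vx vx; have [->|x0] := eqVneq x 0; first by rewrite mul0r; apply: subring0.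
  by apply: (p_valring_nonunit pp pV) => // Vx'; apply: vx; apply: v0.
have [g vp] := valuation_Some vP p0.
have Vp := subring_nat sV p.
have residue x z z' : V ((x - z%:~R) / p%:R) -> V ((x - z'%:~R) / p%:R) -> z%:~R = z'%:~R :> 'F_p.
  move=> Vz Vz'; apply/eqP; rewrite -subr_eq0 -rmorphB -(dvdz_pcharf (pchar_Fp pp)).
  rewrite -[p%:Z]expr1; apply: (valring_int_div pp vV nVp); rewrite expr1.
  by have := subringB sV Vz' Vz; congr V; rewrite rmorphB /=; field.
split=> //.
- exists g; split=> //; split; [|split].
  + by move/VE: Vp; rewrite vp.
  + move=> g0; apply: nVp; apply/VE; rewrite (valuationV vP vp) g0 oppr0.
    by move/VE: Vp; rewrite vp g0.
  + move=> x h vx h0 hn0; apply/(valuation_div vP vp vx)/VE/nu.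
      by apply/VE; rewrite vx.
    by rewrite vx => -[].
move=> O m.
pose res x : 'F_p := if pselect (exists z : int, V ((x - z%:~R) / p%:R)) is left e
  then (projT1 (cid e))%:~R else 0.
have resE x z : V ((x - z%:~R) / p%:R) -> res x = z%:~R.
  move=> Vz; rewrite /res; case: pselect => [e|[]]; last by exists z.
  by case: cid => z' Vz' /=; apply: residue Vz' Vz.
exists res; split.
- move=> x y /VE/digit[a Va] /VE/digit[b Vb]; rewrite (resE _ _ Va) (resE _ _ Vb) -rmorphD.
  by apply: resE; have := subringD sV Va Vb; congr V; rewrite rmorphD /=; field.
- move=> x y /VE Vx /VE Vy; have [[a Va] [b Vb]] := (digit _ Vx, digit _ Vy).
  rewrite (resE _ _ Va) (resE _ _ Vb) -rmorphM.
  apply: resE; have := subringD sV (subringM sV Va Vy) (subringM sV (subring_int sV a) Vb).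
  by congr V; rewrite rmorphM /=; field.
- by rewrite -[RHS](rmorph1 intr); apply: resE; rewrite rmorph1 subrr mul0r; apply: subring0.
- move=> x Ox; have /VE Vx := Ox; have [z Vz] := digit _ Vx; rewrite (resE _ _ Vz).
  have Vpz : V (x / p%:R) <-> z%:~R = 0 :> 'F_p.
    split=> [Vxp|/eqP]; first by
      rewrite -[0](rmorph0 intr); apply: residue Vz _; rewrite rmorph0 subr0.
    rewrite -(dvdz_pcharf (pchar_Fp pp)) -[p%:Z]expr1 => /(valring_div_int vV nVp).
    by rewrite expr1 => Vz'; have := subringD sV Vz Vz'; rewrite -mulrDl subrK.
  rewrite -Vpz; split=> [Vxp|[_]]; last exact: nu.
  split=> // vx; have x0 : x != 0 by apply/eqP => x0; move: vx; rewrite x0 (valuation0 vP).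
  apply: nVp; have -> : p%:R^-1 = x / p%:R * x^-1 by field; rewrite x0 p0.
  by apply: subringM => //; apply/VE; rewrite (valuationV vP vx) oppr0; move/VE: Vx; rewrite vx.
- move=> r; exists (r : nat)%:R; split; first by apply/VE; apply: subring_nat.
  rewrite (resE _ (r : nat)); first by rewrite -[RHS]natr_Zp.
  by rewrite -[X in X - _]/((r : nat)%:~R) subrr mul0r; apply: subring0.
Qed.

(** The digit of [x] is a natural number lifting its residue: the difference has residue 0, hence
    positive value, hence at least the value of [p] by minimality. *)
Lemma p_valuation_p_valring p (K : fieldType) (G : zmodType) (le : G -> G -> Prop)
    (v : K -> option G) :
  p_valuation p le v -> p_valring p (fun x => ole le (Some 0) (v x)).
Proof.
move=> [vP [g [vp [g0 [gn0 gmin]]]] [res [resD resM res1 res0 _]]].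
have [[_ anti _ _ leD] _ _ _] := vP.
set V := fun x => ole le (Some 0) (v x); have vV : valring V := valuation_valring vP.
have sV := vV.1; split=> // [|x Vx].
  rewrite /V (valuationV vP vp) /= => /(leD _ _ g); rewrite add0r addNr => /anti.
  by move=> /(_ g0).
have resN n : res n%:R = n%:R.
  elim: n => [|n IHn]; last first.
    by rewrite !mulrS resD ?IHn ?res1 //; [exact: (subring1 sV)|exact: (subring_nat sV)].
  by apply/res0; [|split]; rewrite ?(valuation0 vP).
exists (res x : nat); set n : nat := res x.
have Vn := subring_nat sV n.
have Vd : V (x - n%:R) by apply: subringB.
have : res (x - n%:R) = 0.
  by apply: (addIr (res n%:R)); rewrite -resD // subrK add0r resN natr_Zp.
move/(res0 _ Vd) => [_ vn0].
have [->|d0] := eqVneq (x - n%:R) 0; first by rewrite mul0r; apply: subring0.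
have [h vh] := valuation_Some vP d0; apply/(valuation_div vP vp vh).
apply: (gmin _ _ vh); first by move: Vd; rewrite /V vh.
by move=> h0; apply: vn0; rewrite vh h0.
Qed.

(** * Valuations with values in the integers *)

Section ValringInt.
Variables (p : nat) (K : fieldType) (V : K -> Prop).
Hypotheses (pp : prime p) (vV : valring V) (nVp : ~ V p%:R^-1).
Let sV := vV.1.
Let p0 := valring_p_neq0 vV nVp.

Lemma valring_expz (k : int) : V (p%:R ^ k) <-> 0 <= k.
Proof.
have Vn (n : nat) : V (p%:R ^ (n : int)).
  by rewrite -exprnP; apply: subringX => //; apply: subring_nat.
split=> [Vk|]; last by case: k.
case: k Vk => // n Vk; case: nVp.
have -> : p%:R^-1 = p%:R ^ Negz n * p%:R ^ (n : int) :> K.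
  by rewrite -[p%:R ^ Negz n]/((p%:R ^+ n.+1)^-1) -exprnP exprS; field; rewrite p0 expf_neq0.
exact: subringM.
Qed.

Lemma valring_int_neq0 (z : int) : z != 0 -> exists k (y : int),
  [/\ k = logn p `|z|%N, z = p%:Z ^+ k * y, y%:~R != 0 :> K & V y%:~R^-1].
Proof.
move=> z0; have z0' : (0 < `|z|)%N by rewrite absz_gt0.
have [k kp e] := pfactor_coprime pp z0'.
set m := logn _ _ in e *.
exists m, (sgz z * k%:Z).
have E : z = p%:Z ^+ m * (sgz z * k%:Z).
  by rewrite {1}[z]intEsg e PoszM mulrA mulrC -rmorphXn.
have [] : (sgz z * k)%:~R != 0 :> K /\ V (sgz z * k)%:~R^-1; last by [].
apply: (valring_coprime_unit pp vV nVp).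
by rewrite dvdzE abszM absz_sg z0 mul1n /= -prime_coprime.
Qed.

End ValringInt.

Local Notation lez := (fun x y : int => x <= y).

Lemma lez_ordered_group : ordered_group lez.
Proof.
split=> [x|x y xy yx|x y z|x y|x y z]; last by rewrite lerD2r.
- exact: lexx.
- by apply/eqP; rewrite eq_le xy.
- exact: le_trans.
- exact/orP/le_total.
Qed.

Section IntValuation.
Variables (p : nat) (K : fieldType) (V : K -> Prop).
Hypotheses (pp : prime p) (vV : valring V) (nVp : ~ V p%:R^-1).
Hypothesis expz_class : forall x, x != 0 -> exists n : int, V (x / p%:R ^ n) /\ V (p%:R ^ n / x).
Let sV := vV.1.
Let p0 := valring_p_neq0 vV nVp.
Let pX (n : int) : p%:R ^ n != 0 :> K := expfz_neq0 n p0.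

(** The exponent [n] for which [x / p ^ n] is a unit of [V]; it is unique since [p ^ k] lies in [V]
    only for [k >= 0]. *)
Let w x : option int :=
  if pselect (x != 0) is left x0 then Some (projT1 (cid (expz_class x0))) else None.

Let w0 : w 0 = None.
Proof. by rewrite /w; case: pselect => // h; case/eqP: (h). Qed.

Let w_Some x : x != 0 -> exists n, [/\ w x = Some n, V (x / p%:R ^ n) & V (p%:R ^ n / x)].
Proof.
move=> x0; rewrite /w; case: pselect => // x0'; case: cid => n [Vn Vn'] /=.
by exists n.
Qed.

Let w_ge x n : ole lez (Some n) (w x) <-> V (x / p%:R ^ n).
Proof.
have [->|x0] := eqVneq x 0; first by rewrite w0 mul0r; split=> // _; exact: subring0.
have [m [-> Vm Vm']] := w_Some x0; rewrite /= -subr_ge0 -(valring_expz vV nVp).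
rewrite expfzDr // -invr_expz; split=> [Vnm|Vn].
  have -> : x / p%:R ^ n = x / p%:R ^ m * (p%:R ^ m / p%:R ^ n).
    by field; rewrite !pX.
  exact: subringM.
have -> : p%:R ^ m / p%:R ^ n = p%:R ^ m / x * (x / p%:R ^ n) by field; rewrite x0 pX.
exact: subringM.
Qed.

Let w_eq x n : x != 0 -> V (x / p%:R ^ n) -> V (p%:R ^ n / x) -> w x = Some n.
Proof.
move=> x0 /w_ge; have [m [-> Vm Vm']] := w_Some x0 => /= nm Vn'.
congr Some; apply/eqP; rewrite eq_le nm andbT -subr_ge0 -(valring_expz vV nVp).
rewrite expfzDr // -invr_expz.
have -> : p%:R ^ n / p%:R ^ m = p%:R ^ n / x * (x / p%:R ^ m) by field; rewrite x0 pX.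
exact: subringM.
Qed.

Let w_valuation : valuation lez w.
Proof.
split; first exact: lez_ordered_group.
- move=> x; have [->|x0] := eqVneq x 0; first by rewrite w0.
  have [n [-> _ _]] := w_Some x0; split=> // x0'.
  by move: x0; rewrite x0' eqxx.
- move=> x y; have [->|x0] := eqVneq x 0; first by rewrite mul0r w0.
  have [->|y0] := eqVneq y 0; first by rewrite mulr0 w0; case: (w x).
  have [n [-> Vn Vn']] := w_Some x0; have [m [-> Vm Vm']] := w_Some y0.
  apply: w_eq; first exact: mulf_neq0.
    by rewrite expfzDr // -mulf_div; apply: subringM.
  by rewrite expfzDr // -mulf_div; apply: subringM.
move=> x y; have [->|x0] := eqVneq x 0; first by right; rewrite add0r; case: (w y) => /=.
have [->|y0] := eqVneq y 0; first by left; rewrite addr0; case: (w x) => /=.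
have [n [En Vn _]] := w_Some x0; have [m [Em Vm _]] := w_Some y0.
have [nm|mn] := orP (le_total n m); [left; rewrite En|right; rewrite Em];
  apply/w_ge; rewrite mulrDl; apply: subringD => //; apply/w_ge.
  by rewrite Em.
by rewrite En.
Qed.

Let w_int (z : int) : z != 0 -> w z%:~R = Some (logn p `|z|%N : int).
Proof.
move=> /(valring_int_neq0 pp vV nVp)[k [y [<- -> y0 Vy]]].
rewrite rmorphM rmorphXn /=; apply: w_eq; first by rewrite mulf_neq0 ?expf_neq0.
  by rewrite -exprnP mulrAC divff ?expf_neq0 // mul1r; exact: subring_int.
by rewrite -exprnP invfM mulrA divff ?expf_neq0 // mul1r.
Qed.

Lemma int_valuation : exists w : K -> option int,
  [/\ valuation lez w,
      forall x n, ole lez (Some n) (w x) <-> V (x / p%:R ^ n) &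
      forall q, w (ratr q) = vp_rat p q].
Proof.
exists w; split=> // q; rewrite /vp_rat; have [->|q0] := eqVneq q 0.
  by rewrite /ratr mul0r w0.
have wVd := valuationV w_valuation (w_int (denq_neq0 q)).
by rewrite /ratr (valuationM w_valuation (w_int _) wVd) ?numq_eq0.
Qed.

End IntValuation.

(* Completeness is only required for sequences of integers: a Cauchy sequence is, after
   scaling by a power of [p] and passing to a subsequence, approximated by one of these. *)
Lemma p_valring_is_Qp p (K : fieldType) (V : K -> Prop) :
  prime p -> p_valring p V ->
  (forall x, x != 0 -> exists n : int, V (x / p%:R ^ n) /\ V (p%:R ^ n / x)) ->
  (forall z : nat -> int, (forall n, (p%:Z ^+ n %| z n.+1 - z n)%Z) ->
    exists l, forall n, V ((l - (z n)%:~R) / p%:R ^+ n)) ->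
  exists w : K -> option int, is_Qp p w.
Proof.
move=> pp pV hZ complete; have [vV nVp _] := pV; have sV := vV.1.
have p0 := valring_p_neq0 vV nVp.
have [w [wP w_ge w_rat]] := int_valuation pp vV nVp hZ; exists w.
have int0 (z : int) : z != 0 -> z%:~R != 0 :> K.
  move=> /(valring_int_neq0 pp vV nVp)[k [y [_ -> y0 _]]].
  by rewrite rmorphM rmorphXn mulf_neq0 ?expf_neq0.
have integral x : exists k : nat, V (p%:R ^+ k * x).
  have [->|x0] := eqVneq x 0; first by exists 0; rewrite mulr0; apply: subring0.
  have [n [Vn _]] := hZ _ x0; case: n Vn => n Vn.
    exists 0; rewrite mul1r -[x](divfK (expfz_neq0 n p0)); apply: subringM => //.
    by apply: subringX => //; apply: subring_nat.
  by exists n.+1; rewrite mulrC; move: Vn; rewrite NegzE -invr_expz invrK.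
have VX n : V (p%:R ^+ n) by apply: subringX => //; apply: subring_nat.
have VXle x (m n : nat) : (n <= m)%N -> V (x / p%:R ^+ m) -> V (x / p%:R ^+ n).
  move=> nm Vm; have -> : x / p%:R ^+ n = x / p%:R ^+ m * p%:R ^+ (m - n).
    by rewrite -{1}(subnK nm) exprD; field; rewrite !expf_neq0.
  exact: subringM.
have wX x k n : V (p%:R ^+ k * x / p%:R ^+ (n + k)) -> V (x / p%:R ^+ n).
  by congr V; rewrite exprD; field; rewrite !expf_neq0.
have natle (n : int) : exists N : nat, n <= N by exists `|n|%N; lia.
have w_le x (n : int) (N : nat) : n <= N -> V (x / p%:R ^+ N) -> ole lez (Some n) (w x).
  move=> nN /(w_ge x N); case: (w x) => //= m; exact: le_trans.
split=> //.
- move=> x n; have [k Vk] := integral x; have [N nN] := natle n.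
  (* The [k] extra digits make up for the later division by [p ^ k]. *)
  have [z Vz] := p_valring_approx pV (N + k) Vk.
  exists (z%:~R / p%:R ^+ k); apply: w_le nN _; apply: (wX _ k).
  have -> : ratr (z%:~R / p%:R ^+ k) = z%:~R / p%:R ^+ k :> K.
    set q : rat := _ / _; rewrite /ratr; apply/eqP; rewrite eqr_div ?expf_neq0 ?int0 ?denq_neq0 //.
    suff e : numq q * p%:Z ^+ k = z * denq q.
      by rewrite -[p%:R]/((p%:Z)%:~R) -rmorphXn -!rmorphM e.
    apply: (@intr_inj rat); rewrite !rmorphM rmorphXn /=.
    apply/eqP; rewrite -eqr_div ?expf_neq0 ?intr_eq0 ?denq_neq0 ?pnatr_eq0 -?lt0n ?prime_gt0 //.
    by rewrite divq_num_den.
  by move: Vz; congr V; field; rewrite !expf_neq0.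
(* Past [M] the terms differ by elements of [V], so one factor [p ^ k] makes the whole tail
   integral. *)
- move=> s sC; have [M sM] := sC 0; have [k Vk] := integral (s M).
  have Vs i : (M <= i)%N -> V (p%:R ^+ k * s i).
    move=> Mi; rewrite -(subrK (s M) (s i)) mulrDr; apply: subringD => //.
    by apply: subringM => //; have /w_ge := sM i M Mi (leqnn _); rewrite divr1.
  have [N sN] := choice (fun n : nat => sC n).
  (* Summing makes [I n] at least [M] and at least every threshold [N j] with [j <= n]. *)
  pose I n := (M + \sum_(j < n.+1) N j)%N.
  have NI n m : (n <= m)%N -> (N n <= I m)%N.
    move=> nm; apply: leq_trans (leq_addl _ _).
    by rewrite (bigD1 (Ordinal (nm : (n < m.+1)%N))) //= leq_addr.
  have VsI n i j : (N n <= i)%N -> (N n <= j)%N -> V (p%:R ^+ k * (s i - s j) / p%:R ^+ n).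
    move=> ni nj; rewrite -mulrA; apply: subringM => //.
    by rewrite [p%:R ^+ n]exprnP; apply/w_ge; exact: sN.
  (* The integers approximating the scaled subsequence are coherent, because its terms of index [n]
     and [n.+1] agree modulo [p ^ n]. *)
  have [z Vz] := choice (fun n => p_valring_approx pV n (Vs (I n) (leq_addr _ _))).
  have [n|l Vl] := complete z.
    apply: (valring_int_div pp vV nVp).
    have Vd := VsI n _ _ (NI n _ (leqnSn n)) (NI n n (leqnn n)).
    have := subringD sV (subringB sV (Vz n) (VXle _ _ _ (leqnSn n) (Vz n.+1))) Vd.
    by congr V; rewrite rmorphB /=; field; rewrite expf_neq0.
  exists (l / p%:R ^+ k) => n; have [m nm] := natle n; exists (I (m + k)%N) => i Ii.
  apply: w_le nm _; apply: (wX _ k).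
  have NIk := NI _ _ (leqnn (m + k)%N).
  have Vd := VsI _ _ _ (leq_trans NIk Ii) NIk.
  have := subringD sV (subringB sV (Vz (m + k)%N) (Vl (m + k)%N)) Vd.
  by congr V; field; rewrite !expf_neq0.
Qed.

(** * Existence of Q_p *)

Section CoherentSequences.
Variable p : nat.

(** Such a sequence presents a p-adic integer, [f n] giving its class modulo [p ^ n]; distinct
    sequences may present the same one. *)
Definition coherent : {pred nat -> int} :=
  fun f => `[< forall n, (p%:Z ^+ n %| f n.+1 - f n)%Z >].

Fact coherent_subring_closed : subring_closed coherent.
Proof.
split=> [|f g /asboolP cf /asboolP cg|f g /asboolP cf /asboolP cg]; apply/asboolP => n.
- by rewrite subrr dvdz0.
- have -> : (f - g) n.+1 - (f - g) n = (f n.+1 - f n) - (g n.+1 - g n).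
    by rewrite -[(f - g) n.+1]/(f n.+1 - g n.+1) -[(f - g) n]/(f n - g n); ring.
  exact: rpredB.
- have -> : (f * g) n.+1 - (f * g) n = (f n.+1 - f n) * g n.+1 + f n * (g n.+1 - g n).
    by rewrite -[(f * g) n.+1]/(f n.+1 * g n.+1) -[(f * g) n]/(f n * g n); ring.
  by apply: rpredD; [apply: dvdz_mulr|apply: dvdz_mull].
Qed.

HB.instance Definition _ := GRing.isSubringClosed.Build (nat -> int) coherent
  coherent_subring_closed.

Record coherent_seq := CoherentSeq { coherent_val : nat -> int; _ : coherent_val \in coherent }.
HB.instance Definition _ := [isSub for coherent_val].
HB.instance Definition _ := [Choice of coherent_seq by <:].
HB.instance Definition _ := [SubChoice_isSubComNzRing of coherent_seq by <:].

Definition coherent_ev n (f : coherent_seq) : int := coherent_val f n.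

Fact coherent_ev_zmod n : zmod_morphism (coherent_ev n).
Proof. by []. Qed.

Fact coherent_ev_monoid n : monoid_morphism (coherent_ev n).
Proof. by []. Qed.

HB.instance Definition _ n := GRing.isZmodMorphism.Build coherent_seq int (coherent_ev n)
  (coherent_ev_zmod n).
HB.instance Definition _ n := GRing.isMonoidMorphism.Build coherent_seq int (coherent_ev n)
  (coherent_ev_monoid n).

(** From index [j] on, a coherent sequence is constant modulo [p ^ j]. *)
Lemma coherent_dvd (f : coherent_seq) j m n : (j <= m)%N -> (j <= n)%N ->
  (p%:Z ^+ j %| coherent_ev m f)%Z -> (p%:Z ^+ j %| coherent_ev n f)%Z.
Proof.
have step i : (j <= i)%N -> (p%:Z ^+ j %| coherent_ev i.+1 f - coherent_ev i f)%Z.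
  move=> ji; have /asboolP/(_ i) := valP f; apply: dvdz_trans.
  by rewrite -(subnK ji) exprD dvdz_mull.
have all i : (p%:Z ^+ j %| coherent_ev (i + j) f - coherent_ev j f)%Z.
  elim: i => [|i IHi]; first by rewrite subrr dvdz0.
  have := rpredD (step (i + j)%N (leq_addl _ _)) IHi.
  by rewrite addrA subrK.
have base i : (j <= i)%N ->
    (p%:Z ^+ j %| coherent_ev i f)%Z = (p%:Z ^+ j %| coherent_ev j f)%Z.
  move=> ji; have := all (i - j)%N; rewrite subnK // => h.
  by rewrite -[coherent_ev i f](subrK (coherent_ev j f)) rpredDl.
by move=> jm jn; rewrite !base.
Qed.
End CoherentSequences.

Lemma expz_dvd_mul p (a b : int) n : prime p -> (p%:Z ^+ n %| a * b)%Z ->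
  exists i j, [/\ (i + j = n)%N, (p%:Z ^+ i %| a)%Z & (p%:Z ^+ j %| b)%Z].
Proof.
move=> pp; have p0 : p%:Z != 0 by rewrite -lt0n prime_gt0.
elim: n a b => [|n IHn] a b pab; first by exists 0, 0; rewrite !dvd1z.
have : (p %| a * b)%Z by apply: dvdz_trans pab; rewrite exprS dvdz_mulr.
rewrite dvdzE abszM /= Euclid_dvdM // => /orP[/(@dvdzP p a)|/(@dvdzP p b)] [c cE].
  have [|i [j [ij pa pb]]] := IHn c b.
    by rewrite -(@dvdz_mul2r p%:Z) // -exprSr mulrAC -cE.
  by exists i.+1, j; rewrite addSn ij cE exprSr; split=> //; apply: dvdz_mul.
have [|i [j [ij pa pb]]] := IHn a c.
  by rewrite -(@dvdz_mul2r p%:Z) // -exprSr -mulrA -cE.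
by exists i, j.+1; rewrite addnS ij cE exprSr; split=> //; apply: dvdz_mul.
Qed.

Lemma expz_dvdn_exp p m n : (1 < p)%N -> (p%:Z ^+ m %| p%:Z ^+ n)%Z = (m <= n)%N.
Proof. by move=> p1; rewrite dvdzE !abszX /= dvdn_Pexp2l. Qed.

Lemma last_true (P : nat -> Prop) N : P 0%N -> ~ P N -> exists k, [/\ (k < N)%N, P k & ~ P k.+1].
Proof.
move=> P0; elim: N => // N IHN nPN; have [PN|/IHN[k [kN Pk nPk]]] := pselect (P N).
  by exists N.
by exists k; split=> //; apply: ltnW.
Qed.

Section CoherentDivisibility.
Variable p : nat.
Hypothesis pp : prime p.
Local Notation Zp := (with_units (coherent_seq p)).
Local Notation ev n f := (coherent_ev n (f : coherent_seq p)).
Let p1 := prime_gt1 pp.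

(** The limit of [f] has p-adic value at most that of [g]: index [n] is enough to test whether
    [p ^ n] divides the limit. *)
Definition coherent_div (f g : Zp) : Prop :=
  forall n, (p%:Z ^+ n %| ev n f)%Z -> (p%:Z ^+ n %| ev n g)%Z.

Lemma coherent_ev_mul n (f g : Zp) : ev n (f * g) = ev n f * ev n g.
Proof. exact: (rmorphM (@coherent_ev p n)). Qed.

Lemma coherent_ev_sub n (f g : Zp) : ev n (f - g) = ev n f - ev n g.
Proof. exact: (rmorphB (@coherent_ev p n)). Qed.

Lemma coherent_ev_int n (z : int) : ev n (z%:~R : Zp) = z.
Proof. by rewrite -[RHS]intz; exact: (rmorph_int (@coherent_ev p n)). Qed.

Lemma coherent_ev_exp n k : ev n (p%:R ^+ k : Zp) = p%:Z ^+ k.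
Proof. by have := coherent_ev_int n (p%:Z ^+ k); rewrite rmorphXn. Qed.

(* [k] is the p-adic valuation of the limit of [f]; it is already visible on [f (k + 1)]. *)
Lemma coherent_div_nonzero (f : Zp) : ~ coherent_div 0 f -> exists k,
  [/\ coherent_div f (p%:R ^+ k), coherent_div (p%:R ^+ k) f,
      (p%:Z ^+ k %| ev k.+1 f)%Z & ~ (p%:Z ^+ k.+1 %| ev k.+1 f)%Z].
Proof.
move=> nf; have [N nN] : exists N, ~ (p%:Z ^+ N %| ev N f)%Z.
  apply: contrapT => h; apply: nf => n _; apply: contrapT => nn; apply: h.
  by exists n.
have [|k [kN fk nfk]] := @last_true (fun i => (p%:Z ^+ i %| ev N f)%Z) N _ nN.
  by rewrite dvd1z.
have fle n : (p%:Z ^+ n %| ev n f)%Z -> (n <= k)%N.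
  move=> fn; rewrite leqNgt; apply/negP => kn; apply: nfk.
  apply: (coherent_dvd (m := n)) => //; apply: dvdz_trans fn.
  by rewrite expz_dvdn_exp.
exists k; split.
- by move=> n /fle nk; rewrite coherent_ev_exp expz_dvdn_exp.
- move=> n; rewrite coherent_ev_exp expz_dvdn_exp // => nk.
  apply: (coherent_dvd (m := N)) => //; first by apply: leq_trans nk (ltnW kN).
  by apply: dvdz_trans fk; rewrite expz_dvdn_exp.
- by apply: (coherent_dvd (m := N)) fk => //; apply: ltnW.
- by move/fle; rewrite ltnn.
Qed.

Lemma coherent_divisibility : divisibility coherent_div.
Proof.
split.
- by move=> f n.
- by move=> f g h fg gh n /fg/gh.
- by move=> f g h fg fh n fn; rewrite coherent_ev_sub rpredB ?fg ?fh.
(* The exponent splits as [i + j] between [f] and [h]; the hypothesis is applied at index [i], and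
   the result is carried back to [i + j]. *)
- move=> f g h fg n; rewrite !coherent_ev_mul => /(expz_dvd_mul pp)[i [j [<- fi hj]]].
  rewrite exprD; apply: dvdz_mul => //.
  have ij : (i <= i + j)%N := leq_addr _ _.
  by apply: (coherent_dvd (m := i)) => //; apply: fg; apply: coherent_dvd fi.
- move=> /(_ 1%N); rewrite -[1 : Zp]/(1%:~R) -[0 : Zp](mulr0z 1) !coherent_ev_int dvdz0.
  by move=> /(_ isT); rewrite -(expr0 p%:Z) expz_dvdn_exp.
Qed.

Lemma coherent_div_total : total_rel coherent_div.
Proof.
move=> f g; have [|nfg] := pselect (coherent_div f g); [by left|right].
have [n [fn gn]] : exists n, (p%:Z ^+ n %| ev n f)%Z /\ ~ (p%:Z ^+ n %| ev n g)%Z.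
  apply: contrapT => h; apply: nfg => n fn; apply: contrapT => gn; apply: h.
  by exists n.
move=> m gm; have mn : (m <= n)%N.
  rewrite leqNgt; apply/negP => nm; apply: gn.
  apply: (coherent_dvd (m := m)) => //; first exact: ltnW.
  by apply: dvdz_trans gm; rewrite expz_dvdn_exp // ltnW.
apply: (coherent_dvd (m := n)) => //.
by apply: dvdz_trans fn; rewrite expz_dvdn_exp.
Qed.

Lemma coherent_div_cancellation : has_cancellation coherent_div.
Proof.
move=> f g h /coherent_div_nonzero[k [_ hk pk npk]] fgh n fn.
have hM m : (m >= k.+1)%N -> (p%:Z ^+ k %| ev m h)%Z /\ ~ (p%:Z ^+ k.+1 %| ev m h)%Z.
  move=> km; split; first by apply: (coherent_dvd (m := k.+1)) => //; apply: ltnW.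
  by move=> ?; apply: npk; apply: (coherent_dvd (m := m)).
(* At index [M] all sequences are known modulo [p ^ n], [p ^ k.+1] and [p ^ (n + k)] at once. *)
set M := (n + k.+1)%N; have kM : (k.+1 <= M)%N := leq_addl _ _.
have nM : (n <= M)%N := leq_addr _ _.
have nkM : (n + k <= M)%N by rewrite /M addnS.
have fM : (p%:Z ^+ n %| ev M f)%Z by apply: coherent_dvd fn.
have [hMk nhMk] := hM _ kM.
have fhM : (p%:Z ^+ (n + k) %| ev M (f * h))%Z.
  by rewrite coherent_ev_mul exprD dvdz_mul.
have /fgh : (p%:Z ^+ (n + k) %| ev (n + k) (f * h))%Z by apply: coherent_dvd fhM.
move=> /(coherent_dvd (n := M) (leqnn _) nkM).
(* Of the [n + k] factors [p] of [g * h], at most [k] come from [h], leaving at least [n] for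
   [g]. *)
rewrite coherent_ev_mul => /(expz_dvd_mul pp)[i [j [ij gi hj]]].
have jk : (j <= k)%N.
  rewrite leqNgt; apply/negP => kj; apply: nhMk; apply: dvdz_trans hj.
  by rewrite expz_dvdn_exp.
have ni : (n <= i)%N by rewrite -(leq_add2r k) -ij leq_add2l.
apply: (coherent_dvd (m := M)) => //.
by apply: dvdz_trans gi; rewrite expz_dvdn_exp.
Qed.

Lemma Qp_exists : exists (K : fieldType) (w : K -> option int), is_Qp p w.
Proof.
have [K [phi [O [sO dO phiS]]]] :=
  divisibility_fraction coherent_divisibility coherent_div_cancellation.
have phi0 f : phi f = 0 <-> coherent_div 0 f by rewrite dO pullback0.
have vO : valring O := pullback_valring coherent_div_total sO dO phiS.
have pX k : phi (p%:R ^+ k) = p%:R ^+ k by rewrite rmorphXn rmorph_nat.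
have pX0 k : p%:R ^+ k != 0 :> K.
  rewrite -pX; apply/eqP => /phi0 /(_ k.+1); rewrite coherent_ev_exp.
  rewrite -[0 : Zp](mulr0z 1) coherent_ev_int dvdz0 => /(_ isT).
  by rewrite expz_dvdn_exp // ltnn.
have p0 : p%:R != 0 :> K by have := pX0 1%N; rewrite expr1.
have dP f g : phi f != 0 -> coherent_div f g -> O (phi g / phi f).
  by move=> f0 /dO[->|[]//]; rewrite mul0r; apply: subring0.
have dP' k f : coherent_div (p%:R ^+ k) f -> O (phi f / p%:R ^+ k).
  by move=> ?; rewrite -pX; apply: dP => //; rewrite pX.
have nOp : ~ O p%:R^-1.
  move=> Op; have /dO/(_ 1%N) : pullback phi O (p%:R ^+ 1) 1.
    by right; rewrite pX rmorph1 mul1r expr1; split=> //; apply/eqP.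
  rewrite coherent_ev_exp -[1 : Zp](expr0 p%:R) coherent_ev_exp => /(_ (dvdzz _)).
  by rewrite expz_dvdn_exp.
exists K; apply: (p_valring_is_Qp (V := O)) => //.
(* Let [k] be the value of [b] in [x = a / b]. At index [k.+1], [a = p ^ k a'] and [b = p ^ k b']
   with [b'] prime to [p]; the digit is [u * a'] for [u] inverse to [b'] modulo [p]. *)
- split=> // x Ox; have [a [b [b0 xE]]] := phiS x.
  have /coherent_div_nonzero[k [bk kb pb npb]] : ~ coherent_div 0 b by move/phi0/eqP; apply/negP.
  have ba : coherent_div b a by apply/dO; right; rewrite -xE; split=> //; apply/eqP.
  have /dvdzP[b' bE] := pb.
  have /dvdzP[a' aE] : (p%:Z ^+ k %| ev k.+1 a)%Z.
    apply: (coherent_dvd (m := k)) => //; apply: ba.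
    by apply: (coherent_dvd (m := k.+1)) pb.
  have b'p : coprimez b' p.
    rewrite coprimez_sym coprimezE prime_coprime //; apply/negP => pb'; apply: npb.
    by rewrite bE mulrC exprSr dvdz_mul ?dvdzz ?dvdzE.
  have /coprimezP[[u v] /= uv] := b'p.
  exists (u * a').
  have -> : (x - (u * a')%:~R) / p%:R = phi (a - b * (u * a')%:~R) / phi (b * p%:R).
    rewrite rmorphB !rmorphM rmorph_nat !rmorph_int xE.
    by field; rewrite p0 b0.
  apply: dP; first by rewrite rmorphM rmorph_nat mulf_neq0.
  move=> n; rewrite coherent_ev_mul coherent_ev_sub coherent_ev_mul coherent_ev_int.
  rewrite -[p%:R : Zp]/(p%:Z%:~R) coherent_ev_int => nbp.
  (* As [b * p] has value [k.+1], only these [n] occur, and divisibility can be checked at index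
     [k.+1], where [a'] and [b'] were read off. *)
  have nk : (n <= k.+1)%N.
    case: n nbp => // n; rewrite exprSr dvdz_mul2r -?lt0n ?prime_gt0 // => bn.
    rewrite ltnS leqNgt; apply/negP => kn; apply: npb.
    apply: (coherent_dvd (m := n.+1)) => //; first exact: leqW.
    by apply: dvdz_trans bn; rewrite expz_dvdn_exp.
  have := coherent_dvd (f := a - b * (u * a')%:~R) (j := n) (m := k.+1) (n := n).
  rewrite !(coherent_ev_sub, coherent_ev_mul, coherent_ev_int); apply=> //.
  apply: (@dvdz_trans (p%:Z ^+ k.+1)); first by rewrite expz_dvdn_exp.
  have -> : ev k.+1 a - ev k.+1 b * (u * a') = p%:Z ^+ k.+1 * (v * a').
    by rewrite aE bE -[X in X * _ - _]mulr1 -uv exprS; ring.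
  exact: dvdz_mulr.
- move=> x x0; have [a [b [b0 xE]]] := phiS x.
  have a0 : phi a != 0 by apply: contra x0 => /eqP a0; rewrite xE a0 mul0r.
  have /coherent_div_nonzero[k [bk kb _ _]] : ~ coherent_div 0 b by move/phi0/eqP; apply/negP.
  have /coherent_div_nonzero[l [al la _ _]] : ~ coherent_div 0 a by move/phi0/eqP; apply/negP.
  exists (Posz l - Posz k); rewrite expfzDr // -invr_expz -!exprnP xE; split.
    have := subringM sO (dP' _ _ la) (dP _ _ b0 bk); rewrite pX.
    by congr O; field; rewrite b0 !pX0.
  have := subringM sO (dP _ _ a0 al) (dP' _ _ kb); rewrite pX.
  by congr O; field; rewrite a0 b0 !pX0.
(* The sequence [z] is itself an element of the ring, and its image is its limit. *)
- move=> z cz; have zP : z \in coherent p by apply/asboolP.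
  pose f : Zp := CoherentSeq zP; exists (phi f) => n.
  rewrite -(rmorph_int phi) -rmorphB; apply: dP' => m.
  rewrite coherent_ev_exp expz_dvdn_exp // coherent_ev_sub coherent_ev_int => mn.
  have := coherent_dvd (f := (f - (z n)%:~R : Zp)) (j := m) (m := n) (n := m) mn (leqnn m).
  by rewrite !coherent_ev_sub !coherent_ev_int subrr dvdz0; apply.
Qed.

End CoherentDivisibility.

(** * Homomorphisms to Q_p *)

Section QpTheory.
Variables (p : nat) (K : fieldType) (w : K -> option int).
Hypotheses (pp : prime p) (QpK : is_Qp p w).
Let wP : valuation lez w. Proof. by case: QpK. Qed.
Let V x := ole lez (Some 0) (w x).
Let vV : valring V := valuation_valring wP.
Let sV := vV.1.

Let w_p : w p%:R = Some 1.
Proof.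
case: QpK => _ wq _ _; rewrite -(ratr_nat K p) wq /vp_rat pnatr_eq0 eqn0Ngt prime_gt0 //=.
rewrite -[p%:R]/((p%:Z)%:Q) numq_int denq_int /= logn1 subr0.
by rewrite lognE pp dvdnn prime_gt0 // divnn prime_gt0 // logn1.
Qed.

Lemma Qp_expr n : w (p%:R ^+ n) = Some (n : int).
Proof.
elim: n => [|n IHn]; first by rewrite expr0 (valuation1 wP).
by rewrite exprS (valuationM wP w_p IHn) -intS.
Qed.

Lemma Qp_ge x (n : nat) : ole lez (Some (n : int)) (w x) <-> V (x / p%:R ^+ n).
Proof.
have [->|x0] := eqVneq x 0; first by rewrite mul0r /V (valuation0 wP).
have [m wx] := valuation_Some wP x0; rewrite wx.
exact: (valuation_div wP (Qp_expr n) wx).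
Qed.

Let nVp : ~ V p%:R^-1.
Proof. by rewrite /V (valuationV wP w_p). Qed.

(** By density [x] is congruent modulo [p] to a rational [q], which is then p-integral; inverting
    its denominator modulo [p] gives the integer digit. *)
Lemma Qp_p_valring : p_valring p V.
Proof.
split=> // x Vx; case: QpK => _ wq dense _; have [q wxq] := dense x 1.
have p0 := valring_p_neq0 vV nVp.
have Vxq : V ((x - ratr q) / p%:R) by have /(Qp_ge _ 1) := wxq; rewrite expr1.
have Vq : V (ratr q).
  rewrite -[ratr q](subKr x); apply: subringB => //.
  by rewrite -(divfK p0 (x - ratr q)); apply: subringM => //; exact: subring_nat.
have [q0|q0] := eqVneq q 0.
  by exists 0; move: Vxq; rewrite q0 /ratr mul0r.
have pden : ~~ (p %| denq q)%Z.
  apply/negP; rewrite dvdzE /= => pd.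
  have d0 : (0 < `|denq q|)%N by rewrite absz_gt0 denq_neq0.
  have n0 : (0 < `|numq q|)%N by rewrite absz_gt0 numq_eq0.
  move: Vq; rewrite /V wq /vp_rat (negPf q0) /= subr_ge0 lez_nat => ld.
  have : (0 < logn p `|denq q|)%N by rewrite logn_gt0 mem_primes pp d0.
  move=> /leq_trans/(_ ld); rewrite logn_gt0 mem_primes pp n0 /= => pn.
  have := coprime_num_den q; rewrite /coprime => /eqP g1.
  have : (p %| gcdn `|numq q| `|denq q|)%N by rewrite dvdn_gcd pn pd.
  by rewrite g1 dvdn1 => /eqP p1; move: pp; rewrite p1.
have [d0 Vd] := valring_coprime_unit pp vV nVp pden.
have /coprimezP[[u v] /= uv] : coprimez (denq q) p.
  by rewrite coprimez_sym coprimezE /= prime_coprime // -dvdzE.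
exists (u * numq q).
have E : 1 - (u * denq q)%:~R = v%:~R * p%:R :> K.
  have h : (u * denq q)%:~R + v%:~R * p%:R = 1 :> K.
    by rewrite -[p%:R]/((p%:Z)%:~R) -rmorphM -rmorphD uv.
  by apply/eqP; rewrite subr_eq [X in _ == X]addrC h.
have -> : (x - (u * numq q)%:~R) / p%:R = (x - ratr q) / p%:R
    + (numq q)%:~R * (denq q)%:~R^-1 * v%:~R.
  suff -> : v%:~R = (1 - (u * denq q)%:~R) / p%:R :> K.
    by rewrite /ratr !rmorphM; field; rewrite p0 d0.
  by rewrite E mulfK.
apply: (subringD sV Vxq); apply: (subringM sV); last exact: (subring_int sV).
by apply: (subringM sV) => //; exact: (subring_int sV).
Qed.

Lemma Qp_eq0 x : (forall n : nat, V (x / p%:R ^+ n)) -> x = 0.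
Proof.
move=> Vx; apply/eqP/negPn/negP => x0; have [m wx] := valuation_Some wP x0.
have := (Qp_ge x `|m|.+1).2 (Vx _); by rewrite wx /=; lia.
Qed.

Lemma Qp_complete (z : nat -> int) : (forall n, (p%:Z ^+ n %| z n.+1 - z n)%Z) ->
  exists l, forall n, V ((l - (z n)%:~R) / p%:R ^+ n).
Proof.
move=> cz; have zij n i : V (((z (n + i)%N)%:~R - (z n)%:~R) / p%:R ^+ n).
  rewrite -rmorphB; apply: (valring_div_int vV nVp).
  elim: i => [|i IHi]; first by rewrite addn0 subrr dvdz0.
  rewrite addnS -(subrK (z (n + i)%N) (z _)) -addrA rpredD //.
  by apply: dvdz_trans (cz _); rewrite exprD dvdz_mulr.
have [_ _ _ /(_ (fun n => (z n)%:~R))[n|l lim]] := QpK.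
  exists `|n|%N => i j ni nj.
  have Vd i' : (`|n| <= i')%N -> V (((z i')%:~R - (z `|n|%N)%:~R) / p%:R ^+ `|n|).
    by move=> ni'; have := zij `|n|%N (i' - `|n|)%N; rewrite subnKC.
  have := subringB sV (Vd _ ni) (Vd _ nj); rewrite -mulrBl opprB addrA subrK => /(Qp_ge _ _).2.
  by case: (w _) => //= m; lia.
exists l => n; have [N HN] := lim n.
have Vl := (Qp_ge _ _).1 (HN (n + N)%N (leq_addl _ _)).
by have := subringB sV (zij n N) Vl; congr V; ring.
Qed.

End QpTheory.

(* [p^k x] and [p^k y] are limits of the same sequence of integers. *)
Definition same_approx p (K L : fieldType) (V : K -> Prop) (W : L -> Prop) x y : Prop :=
  exists k, forall n, exists z : int,
    V ((p%:R ^+ k * x - z%:~R) / p%:R ^+ n) /\ W ((p%:R ^+ k * y - z%:~R) / p%:R ^+ n).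

Section SameApprox.
Variables (p : nat) (K L : fieldType) (V : K -> Prop) (W : L -> Prop).
Hypotheses (pp : prime p) (pV : p_valring p V) (pW : p_valring p W).
Let vV : valring V. Proof. by case: pV. Qed.
Let sV := vV.1.
Let nVp : ~ V p%:R^-1. Proof. by case: pV. Qed.
Let vW : valring W. Proof. by case: pW. Qed.
Let sW := vW.1.
Let nWp : ~ W p%:R^-1. Proof. by case: pW. Qed.
Local Notation T := (same_approx p V W).

Let approxB (M : fieldType) (U : M -> Prop) k l n x y (z t : int) : subring U ->
  U ((p%:R ^+ k * x - z%:~R) / p%:R ^+ n) -> U ((p%:R ^+ l * y - t%:~R) / p%:R ^+ n) ->
  U ((p%:R ^+ (k + l) * (x - y) - (p%:Z ^+ l * z - p%:Z ^+ k * t)%:~R) / p%:R ^+ n).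
Proof.
move=> sU Ux Uy; have UX i : U (p%:R ^+ i) by apply: subringX => //; apply: subring_nat.
have := subringB sU (subringM sU (UX l) Ux) (subringM sU (UX k) Uy).
by congr U; rewrite rmorphB !rmorphM !rmorphXn /= exprD; ring.
Qed.

(** With [X = p ^ k * x] and [Y = p ^ l * y], one has [X Y - z t = (X - z) Y + z (Y - t)], and [Y]
    is integral, being close to the integer [t]. *)
Let approxM (M : fieldType) (U : M -> Prop) k l n x y (z t : int) : valring U -> ~ U p%:R^-1 ->
  U ((p%:R ^+ k * x - z%:~R) / p%:R ^+ n) -> U ((p%:R ^+ l * y - t%:~R) / p%:R ^+ n) ->
  U ((p%:R ^+ (k + l) * (x * y) - (z * t)%:~R) / p%:R ^+ n).
Proof.
move=> vU nUp Ux Uy; have sU := vU.1; have p0 := valring_p_neq0 vU nUp.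
have UX i : U (p%:R ^+ i) by apply: subringX => //; apply: subring_nat.
have Uky : U (p%:R ^+ l * y).
  rewrite -(subrK t%:~R (_ * y)); apply: subringD => //; last exact: subring_int.
  by rewrite -(divfK (expf_neq0 n p0) (_ - _)); apply: subringM.
have := subringD sU (subringM sU Ux Uky) (subringM sU (subring_int sU z) Uy).
by congr U; rewrite rmorphM /= exprD; ring.
Qed.

Lemma same_approxB x y x' y' : T x y -> T x' y' -> T (x - x') (y - y').
Proof.
move=> [k Txy] [l Txy']; exists (k + l)%N => n.
have [[z [Vz Wz]] [t [Vt Wt]]] := (Txy n, Txy' n).
by exists (p%:Z ^+ l * z - p%:Z ^+ k * t); split; apply: approxB.
Qed.

Lemma same_approxM x y x' y' : T x y -> T x' y' -> T (x * x') (y * y').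
Proof.
move=> [k Txy] [l Txy']; exists (k + l)%N => n.
have [[z [Vz Wz]] [t [Vt Wt]]] := (Txy n, Txy' n).
by exists (z * t); split; apply: approxM.
Qed.

Lemma same_approx1 : T 1 1.
Proof.
exists 0 => n; exists 1; rewrite !mulr1 !subrr !mul0r.
by split; apply: subring0.
Qed.

(** The difference [y - y'] shares its approximations with 0. Integers close to 0 for [V] are
    divisible by high powers of [p], hence close to 0 for [W] as well. *)
Lemma same_approx_uniq x y y' : (forall t, (forall n : nat, W (t / p%:R ^+ n)) -> t = 0) ->
  T x y -> T x y' -> y = y'.
Proof.
move=> sep Txy Txy'; apply/eqP; rewrite -subr_eq0; apply/eqP.
have p0 := valring_p_neq0 vW nWp.
have := same_approxB Txy Txy'; rewrite subrr => -[k T0]; apply: sep => n.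
have [z [Vz Wz]] := T0 (n + k)%N.
have Wz' : W (z%:~R / p%:R ^+ (n + k)).
  apply: (valring_div_int vW nWp); apply: (valring_int_div pp vV nVp).
  by have := subringN sV Vz; rewrite mulr0 sub0r mulNr opprK.
have := subringD sW Wz Wz'; congr W; rewrite exprD.
by field; rewrite !expf_neq0.
Qed.

(** The integer approximations of [p ^ k * x] form a coherent sequence, which converges in [L]. *)
Lemma same_approx_exists x :
  (forall z : nat -> int, (forall n, (p%:Z ^+ n %| z n.+1 - z n)%Z) ->
    exists l, forall n, W ((l - (z n)%:~R) / p%:R ^+ n)) ->
  (exists k, V (p%:R ^+ k * x)) -> exists y, T x y.
Proof.
move=> complete [k Vx]; have p0 := valring_p_neq0 vV nVp.
have p0' := valring_p_neq0 vW nWp.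
have [z Vz] := choice (fun n => p_valring_approx pV n Vx).
have [n|l Wl] := complete z.
  apply: (valring_int_div pp vV nVp).
  have := subringB sV (Vz n) (subringM sV (subring_nat sV p) (Vz n.+1)).
  by congr V; rewrite rmorphB /= exprS; field; rewrite p0 expf_neq0.
exists (l / p%:R ^+ k), k => n; exists (z n); split=> //.
by rewrite mulrCA divff ?expf_neq0 // mulr1.
Qed.

End SameApprox.

(** Totality now does what maximality did before: it makes [O] a valuation ring. *)
Lemma in_SpecDp_p_valring p (A : comUnitRingType) (d : A -> A -> Prop) :
  prime p -> (p%:R : A) \is a GRing.unit -> in_SpecDp p d ->
  exists (K : fieldType) (phi : {rmorphism A -> K}) (V : K -> Prop),
    p_valring p V /\ forall a b, d a b <-> pullback phi V a b.
Proof.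
move=> pp pU [dP dt dC]; have dD : divisibility d by case: dP.
have [K [phi [O [sO dO phiS]]]] := divisibility_fraction dD dC.
exists K, phi, O; split=> //; apply: fermat_p_valring => //.
- exact: pullback_valring dt sO dO phiS.
- exact: pullback_p_nonunit pU dP dO.
- exact: (pullback_kochen pU dP dC dO phiS sO).
Qed.

(** [delta a] is the element with the same integer approximations as [phi a]. The archimedean
    property makes some [p ^ k * phi a] integral, completeness gives existence, and uniqueness gives
    the ring laws. *)
Lemma p_archimedean_ring_hom p (A : comUnitRingType) (d : A -> A -> Prop)
    (K : fieldType) (w : K -> option int) :
  prime p -> (p%:R : A) \is a GRing.unit -> in_SpecDp p d -> p_archimedean p d ->
  is_Qp p w -> exists delta : A -> K, ring_hom delta.
Proof.
move=> pp pU dS darch QpK; have [F [phi [V [pV dV]]]] := in_SpecDp_p_valring pp pU dS.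
have pW := Qp_p_valring pp QpK; set W := fun x => _ in pW.
have [sV _] : valring V by case: pV.
have arch a : exists k, V (p%:R ^+ k * phi a).
  have [m /dV[a0|[_]]] := darch a; first by exists 0; rewrite a0 mulr0; apply: subring0.
  case: m => m Va.
    exists 0; rewrite mul1r; have pm0 : phi (p%:R ^+ m) != 0.
      by rewrite -unitfE rmorph_unit // unitrX.
    rewrite -(divfK pm0 (phi a)); apply: subringM => //.
    by rewrite rmorphXn rmorph_nat; apply: subringX => //; apply: subring_nat.
  exists m.+1; move: Va; rewrite -[p%:R ^ Negz m]/((p%:R ^+ m.+1)^-1).
  by rewrite rmorphV ?unitrX // invrK rmorphXn rmorph_nat mulrC.
have [delta deltaP] := choice (fun a =>
  same_approx_exists pp pV pW (Qp_complete pp QpK) (arch a)).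
have uniq a y : same_approx p V W (phi a) y -> delta a = y.
  move=> Ty; exact: (same_approx_uniq pp pV pW (Qp_eq0 pp QpK) (deltaP a) Ty).
exists delta; split=> [a b|a b|].
(* Approximations are compatible with subtraction, so additivity is obtained from
   [phi a = phi (a + b) - phi b]. *)
- apply/eqP; rewrite -subr_eq; apply/eqP/esym/uniq.
  rewrite -[phi a](addrK (phi b)) -rmorphD; exact: same_approxB.
- by apply: uniq; rewrite rmorphM; apply: same_approxM.
- by apply: uniq; rewrite rmorph1; apply: same_approx1.
Qed.

(** For [phi a] nonzero the exponent is its value, which is an integer. *)
Lemma Qp_p_archimedean p (A : comUnitRingType) (K : fieldType) (w : K -> option int)
    (phi : {rmorphism A -> K}) :
  prime p -> (p%:R : A) \is a GRing.unit -> is_Qp p w ->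
  p_archimedean p (pullback phi (fun x => ole lez (Some 0) (w x))).
Proof.
move=> pp pU QpK a; set V := fun x => _; have wP : valuation lez w by case: QpK.
have pV := Qp_p_valring pp QpK; rewrite -/V in pV; have [vV nVp _] := pV.
have p0 := valring_p_neq0 vV nVp.
have pX0 n : phi (p%:R ^+ n) <> 0 by apply/eqP; rewrite rmorphXn rmorph_nat expf_neq0.
have [a0|a0] := eqVneq (phi a) 0; first by exists 0; left.
have [m wa] := valuation_Some wP a0; case: m wa => m wa.
  exists (m : int); right; split; first exact: pX0.
  by rewrite -exprnP rmorphXn rmorph_nat; apply: (Qp_ge pp QpK _ _).1; rewrite wa /=.
exists (Negz m); right; rewrite -[(p%:R : A) ^ Negz m]/((p%:R ^+ m.+1)^-1).
rewrite rmorphV ?unitrX // invrK; split.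
  by apply/eqP; rewrite invr_eq0; apply/eqP.
by rewrite /V rmorphXn rmorph_nat (valuationM wP wa (Qp_expr pp QpK _)) NegzE addNr.
Qed.

Theorem theorem3p6 (p : nat) (A : comUnitRingType) :
  prime p ->
  (* Q ⊆ A : every nonzero integer is invertible in A *)
  (forall n : nat, (n.+1)%:R \is a @GRing.unit A) ->
  (* (a) <-> (b) *)
  ((exists d : A -> A -> Prop, in_SpecDp p d) <->
   (exists d : A -> A -> Prop, p_divisibility p d)) /\
  (* (b) <-> (c) *)
  ((exists d : A -> A -> Prop, p_divisibility p d) <->
   (exists (K : fieldType) (G : zmodType) (le : G -> G -> Prop)
           (v : K -> option G) (delta : A -> K),
      [/\ char0 K, p_valuation p le v & ring_hom delta])) /\
  (* p-archimedean points of Spec D_p(A) <-> homomorphisms A -> Q_p *)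
  ((exists d : A -> A -> Prop, in_SpecDp p d /\ p_archimedean p d) <->
   (exists (K : fieldType) (w : K -> option int) (delta : A -> K),
      is_Qp p w /\ ring_hom delta)).
Proof.
move=> pp QA; have pU : (p%:R : A) \is a GRing.unit by rewrite -(prednK (prime_gt0 pp)).
have bc : (exists d : A -> A -> Prop, p_divisibility p d) ->
    exists (K : fieldType) (G : zmodType) (le : G -> G -> Prop)
      (v : K -> option G) (delta : A -> K),
      [/\ char0 K, p_valuation p le v & ring_hom delta].
  move=> [d /(p_divisibility_p_valring pp pU)[K [phi [V pV]]]].
  have [G [le [v vP]]] := p_valring_p_valuation pp pV.
  exists K, G, le, v, phi; split=> //; last exact: rmorphism_ring_hom.
  (* Positive integers are units of [A], so their images in [K] are nonzero. *)
  by move=> n; rewrite -(rmorph_nat phi) -unitfE rmorph_unit.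
have ca (K : fieldType) (G : zmodType) (le : G -> G -> Prop)
    (v : K -> option G) (delta : A -> K) :
    p_valuation p le v -> ring_hom delta -> exists d : A -> A -> Prop, in_SpecDp p d.
  move=> /p_valuation_p_valring pV /ring_hom_rmorphism[phi _].
  by exists (pullback phi (fun x => ole le (Some 0) (v x))); apply: pullback_in_SpecDp.
have ab (d : A -> A -> Prop) : in_SpecDp p d -> p_divisibility p d by case.
split; [|split].
- split=> [[d /ab]|/bc[K [G [le [v [delta [_ pv hd]]]]]]]; first by exists d.
  exact: ca pv hd.
- split=> // -[K [G [le [v [delta [_ pv hd]]]]]].
  by have [d /ab] := ca _ _ _ _ _ pv hd; exists d.
split=> [[d [dS darch]]|[K [w [delta [QpK /ring_hom_rmorphism[phi _]]]]]].
  have [K [w QpK]] := Qp_exists pp; exists K, w.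
  by have [delta] := p_archimedean_ring_hom pp pU dS darch QpK; exists delta.
exists (pullback phi (fun x => ole (fun x y : int => x <= y) (Some 0) (w x))).
split; last exact: Qp_p_archimedean.
exact/pullback_in_SpecDp/Qp_p_valring.
Qed.
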